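(* Let $r>1$ be an integer. Then for any $k\in\mathbb{N}$, with $v$ denoting the number of non-zero base $b$ digits of $k$, and for all $f\in\mathcal{H}_r$ we have $$|\hat f(k)|\le\sum_{s=v}^r\left|\int_0^1f^{(s)}(x)\,dx\right|\frac{b^{-\mu_{s,\mathrm{per}}(k)}}{(2\sin\frac\pi b)^s}\left(1+\frac1b+\frac1{b(b+1)}\right)^{\max(0,s-2)}+\int_0^1|f^{(r)}(x)|\,dx\;\frac{2\,b^{-\mu_{r,\mathrm{per}}(k)}}{(2\sin\frac\pi b)^r}\left(1+\frac1b+\frac1{b(b+1)}\right)^{r-2}\left(3+\frac2b+\frac{2b+1}{b-1}\right),$$ where for $v>r$ the empty sum $\sum_{s=v}^r$ is defined as $0$.
   Context: Let $b\ge 2$ be an integer and $\omega_b=e^{2\pi \mathrm{i}/b}$; $\mathbb{N}=\{1,2,\ldots\}$. Each $k\in\mathbb{N}$ has the base $b$ expansion $k=\kappa_1b^{a_1-1}+\cdots+\kappa_vb^{a_v-1}$ with $v\ge1$, $0<\kappa_1,\ldots,\kappa_v<b$ and $a_1>\cdots>a_v>0$ integers; for $k=0$ set $v=0$. For $x\in[0,1)$ with base $b$ representation $x=\frac{x_1}{b}+\frac{x_2}{b^2}+\cdots$, $0\le x_i<b$, infinitely many $x_i\neq b-1$, the $k$th Walsh function is $\mathrm{wal}_k(x)=\omega_b^{\kappa_1x_{a_1}+\cdots+\kappa_vx_{a_v}}$, and $\mathrm{wal}_0(x)=1$. The $k$th Walsh coefficient of $f:[0,1]\to\mathbb{R}$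 is $\hat f(k)=\int_0^1f(x)\overline{\mathrm{wal}_k(x)}\,dx$. For integers $r\ge0$, $k\ge0$ define $\mu_{r,\mathrm{per}}(k)=0$ if $r=0$ or $k=0$; $\mu_{r,\mathrm{per}}(k)=a_1+\cdots+a_v+(r-v)a_v$ if $1\le v<r$; and $\mu_{r,\mathrm{per}}(k)=a_1+\cdots+a_r$ if $v\ge r\ge1$. For an integer $r>1$, $\mathcal{H}_r$ is the Sobolev space of real-valued functions $f:[0,1]\to\mathbb{R}$ (with $f,f',\ldots,f^{(r-1)}$ absolutely continuous and $f^{(r)}\in L_2([0,1])$) with inner product $$\langle f,g\rangle_r=\sum_{s=0}^{r-1}\int_0^1f^{(s)}(x)\,dx\int_0^1g^{(s)}(x)\,dx+\int_0^1f^{(r)}(x)g^{(r)}(x)\,dx,$$ where $f^{(s)}$ is the $s$th derivative of $f$ and $f^{(0)}=f$. *)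

(* Defs.v *)
From HB Require Import structures.
From mathcomp Require Export all_boot all_order all_algebra.
From mathcomp Require Export all_classical all_reals all_analysis.
From mathcomp Require Export complex.
From mathcomp Require Import ring lra zify.

Set Implicit Arguments.
Unset Strict Implicit.
Unset Printing Implicit Defensive.

Import Order.TTheory GRing.Theory Num.Theory numFieldNormedType.Exports.

Local Open Scope classical_set_scope.
Local Open Scope ring_scope.

(* Coefficient of b ^ (a - 1) in the base b expansion of k; positions start
   at 1. *)
Definition nat_digit (b k a : nat) : nat := ((k %/ b ^ a.-1) %% b)%N.

(* The positions a_1 > ... > a_v > 0 of the nonzero digits of k. Positions
   beyond k need not be searched, since k < b ^ k. *)
Definition digit_pos (b k : nat) : seq nat :=
  [seq a <- rev (iota 1 k) | nat_digit b k a != 0%N].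

Definition num_digits (b k : nat) : nat := size (digit_pos b k).

Lemma digit_pos_sorted (b k : nat) : sorted gtn (digit_pos b k).
Proof.
apply: sorted_filter; first by move=> x y z /= xy yz; exact: ltn_trans yz xy.
by rewrite rev_sorted iota_ltn_sorted.
Qed.

Lemma digit_posE (b k : nat) : (2 <= b)%N ->
  k = (\sum_(a <- digit_pos b k) nat_digit b k a * b ^ a.-1)%N.
Proof.
move=> b2; rewrite /digit_pos big_filter big_mkcond /= (eq_bigr
  (fun a => nat_digit b k a * b ^ a.-1)%N); last first.
  by move=> a _; case: eqP => // ->; rewrite mul0n.
rewrite (perm_big (iota 1 k)); last by rewrite perm_rev.
have -> : iota 1 k = [seq i.+1 | i <- index_iota 0 k].
  by rewrite /index_iota subn0 -[1%N]addn0 iotaDl.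
rewrite big_map.
suff H n : k = (\sum_(0 <= i < n) nat_digit b k i.+1 * b ^ i
                + k %/ b ^ n * b ^ n)%N.
  have kb : (k %/ b ^ k = 0)%N by apply: divn_small; exact: ltn_expl.
  by have := H k; rewrite kb mul0n addn0.
elim: n => [|n IH]; first by rewrite big_nil expn0 divn1 muln1.
rewrite big_nat_recr//= {1}IH -addnA; congr addn.
rewrite /nat_digit /= expnS [in RHS](mulnC b) divnMA.
rewrite {1}(divn_eq (k %/ b ^ n)%N b) mulnDl addnC; congr addn.
by rewrite -mulnA (mulnC (b ^ n)%N).
Qed.

(* i-th base b digit of x, positions starting at 1. For x in [0, 1[ this is the
   expansion of x with infinitely many digits distinct from b - 1, as shown
   below; at x = 1 all digits are 0. *)
Definition real_digit (R : realType) (b : nat) (x : R) (i : nat) : nat :=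
  (Num.truncn (x * b%:R ^+ i) %% b)%N.

Section real_digit_theory.
Context (R : realType) (b : nat) (x : R).
Hypotheses (b2 : (2 <= b)%N) (x0 : 0 <= x) (x1 : x < 1).

Let T n := Num.truncn (x * b%:R ^+ n).

Let b_gt0 : 0 < b%:R :> R. Proof. by rewrite ltr0n; lia. Qed.

Let T_itv n : (T n)%:R <= x * b%:R ^+ n < (T n).+1%:R.
Proof. by apply: truncn_itv; rewrite mulr_ge0// exprn_ge0// ler0n. Qed.

Let TS n : T n.+1 = (b * T n + real_digit b x n.+1)%N.
Proof.
suff -> : T n = (T n.+1 %/ b)%N by rewrite mulnC -divn_eq.
have /andP[l1 l2] := T_itv n.+1.
apply/eqP; rewrite /T truncn_eq ?mulr_ge0 ?exprn_ge0 ?ler0n//.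
apply/andP; split.
  rewrite -(ler_pM2r b_gt0) -natrM -mulrA -exprSr.
  by apply: le_trans l1; rewrite ler_nat leq_divM.
rewrite -(ltr_pM2r b_gt0) -natrM -mulrA -exprSr.
by apply: (lt_le_trans l2); rewrite ler_nat -ltn_divLR; lia.
Qed.

Lemma real_digit_ltn i : (real_digit b x i < b)%N.
Proof. by rewrite ltn_mod; lia. Qed.

Lemma real_digit_cvg :
  (fun n => \sum_(1 <= i < n.+1) (real_digit b x i)%:R / b%:R ^+ i)
    @ \oo --> x.
Proof.
have sumE n : \sum_(1 <= i < n.+1) (real_digit b x i)%:R / b%:R ^+ i
    = (T n)%:R / b%:R ^+ n :> R.
  elim: n => [|n IH].
    rewrite big_geq// /T expr0 mulr1 divr1.
    by have -> : Num.truncn x = 0%N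
      by apply/eqP; rewrite truncn_eq// x0.
  rewrite big_nat_recr//= IH TS natrD natrM exprS.
  by field; rewrite expf_neq0 gt_eqF.
have eb : (fun n => (b%:R^-1 : R) ^+ n) @ \oo --> (0 : R).
  apply: cvg_expr; rewrite ger0_norm ?invr_ge0 ?ler0n//.
  by rewrite invf_lt1// ltr1n.
apply: (@squeeze_cvgr _ _ _ _ (fun n => x - b%:R^-1 ^+ n) (fun=> x)).
- apply: nearW => n; rewrite sumE exprVn.
  have bn : 0 < b%:R ^+ n :> R by rewrite exprn_gt0.
  have /andP[l1 l2] := T_itv n.
  rewrite ler_pdivrMr// l1 andbT ler_pdivlMr// mulrBl mulVf ?gt_eqF//.
  by rewrite lerBlDr natr1 ltW.
- by rewrite -[X in _ --> X]subr0; apply: cvgB => //; exact: cvg_cst.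
- exact: cvg_cst.
Qed.

Lemma real_digit_infinite N :
  exists2 i, (N < i)%N & real_digit b x i != b.-1.
Proof.
apply: contrapT => H.
have dE i : (N < i)%N -> real_digit b x i = b.-1.
  by move=> Ni; apply/eqP/negPn/negP => d; apply: H; exists i.
have TE m : (T (N + m)).+1 = (b ^ m * (T N).+1)%N.
  elim: m => [|m IH]; first by rewrite addn0 expn0 mul1n.
  rewrite addnS TS dE; last by lia.
  by rewrite expnS -mulnA -IH; lia.
have /andP[_ l2] := T_itv N.
pose e := (T N).+1%:R - x * b%:R ^+ N.
have e0 : 0 < e by rewrite subr_gt0.
have [m me] : exists m, e^-1 < (b ^ m)%:R.
  exists (Num.truncn e^-1).+1; apply: (lt_trans (truncnS_gt _)).
  by rewrite ltr_nat ltn_expl.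
have /andP[l1 _] := T_itv (N + m).
have bm : 0 < (b ^ m)%:R :> R by rewrite ltr0n expn_gt0; lia.
have : e * (b ^ m)%:R <= 1.
  rewrite /e mulrBl -natrM mulnC -TE -mulrA natrX -exprD -natr1.
  by rewrite lerBlDr addrC lerD2l.
by rewrite leNgt -ltr_pdivrMl// mulr1 me.
Qed.

End real_digit_theory.

Definition omega (R : realType) (b : nat) : R[i] :=
  (cos (2 * pi / b%:R) +i* sin (2 * pi / b%:R))%C.

Definition wal (R : realType) (b k : nat) (x : R) : R[i] :=
  omega R b ^+ (\sum_(a <- digit_pos b k) nat_digit b k a * real_digit b x a)%N.

Definition complex_integral (R : realType) (D : set R) (g : R -> R[i]) : R[i] :=
  (Rintegral lebesgue_measure D (fun x => complex.Re (g x)) +i*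
   Rintegral lebesgue_measure D (fun x => complex.Im (g x)))%C.

Definition walsh_coef (R : realType) (b : nat) (f : R -> R) (k : nat) : R[i] :=
  complex_integral `[0, 1]%classic (fun x => (f x)%:C%C * (wal b k x)^*).

(* last 0 a is a_v, and sumn (take r a) is a_1 + ... + a_r. *)
Definition mu_per (b r k : nat) : nat :=
  let a := digit_pos b k in
  let v := num_digits b k in
  if (r == 0%N) || (k == 0%N) then 0%N
  else if (v < r)%N then (sumn a + (r - v) * last 0 a)%N
  else sumn (take r a).

Definition abs_continuous (R : realType) (a c : R) (g : R -> R) : Prop :=
  forall e : R, 0 < e -> exists2 d : R, 0 < d &
    forall (n : nat) (u w : 'I_n -> R),
      (forall i, [/\ a <= u i, u i <= w i & w i <= c]) ->
      trivIset [set: 'I_n] (fun i => `]u i, w i[%classic) ->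
      \sum_(i < n) (w i - u i) < d ->
      \sum_(i < n) `|g (w i) - g (u i)| < e.

(* Functions on [0, 1] are represented by functions R -> R of which only the
   values on [0, 1] matter: derivatives are limits of difference quotients
   within [0, 1], hence one-sided at 0 and 1. *)
Definition diff_quot01 (R : realType) (f : R -> R) (x : R) :=
  (fun y => (f y - f x) / (y - x)) @ within `[0, 1]%classic x^'.

Definition derivable01 (R : realType) (f : R -> R) (x : R) : Prop :=
  cvg (diff_quot01 f x).

(* Junk value (that of a nonexistent limit) where f is not derivable. *)
Definition derive01 (R : realType) (f : R -> R) (x : R) : R :=
  lim (diff_quot01 f x).

Definition derive01n (R : realType) (s : nat) (f : R -> R) : R -> R :=
  iter s (@derive01 R) f.

(* The derivative of order r exists only almost everywhere, by absolute
   continuity of the one of order r - 1; the junk values of derive01 on the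
   exceptional null set affect neither membership in L_2 nor any integral. *)
Definition sobolev (R : realType) (r : nat) (f : R -> R) : Prop :=
  [/\ forall s x, (s.+1 < r)%N -> x \in `[0, 1] ->
        derivable01 (derive01n s f) x,
      forall s, (s < r)%N -> abs_continuous 0 1 (derive01n s f) &
      derive01n r f \_ `[0, 1]%classic \in Lfun lebesgue_measure 2%:E].

(* Main.v *)
(* Let k have leading digit m at position a and let k' be k without it. For f
   absolutely continuous, integration by parts gives fhat(k) = - int f' J, where
   J is the primitive of the conjugate of wal_k vanishing at 0 and 1. On
   elementary intervals J is affine, and

     b^a J(x) = (1 - z)^-1 conj(wal_k'(x)) + (y - (1 - z)^-1) conj(wal_k(x)),

   with z = conj(omega)^m and y the fractional part of x b^a. Expanding each digit
   of y in a discrete Fourier series bounds |fhat(k)| by a combination of the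
   Walsh coefficients of f' at k', at k, and at k with one more leading digit,
   with coefficients b^-a / |1 - omega| and b^-(a+c) / |1 - omega|. Iterating r
   times, the Walsh coefficient at 0 produces the means of the derivatives, each
   step gains the power of b prescribed by mu_per, and the geometric series over
   the position of the additional digit costs the constant factor of the theorem.
   After r steps the remaining coefficients are at most the L_1 norm of f^(r).

   That f^(r-1) is the integral of f^(r) is Lebesgue's theorem: the variation of an
   absolutely continuous function is absolutely continuous, so its Stieltjes
   measure has a Radon-Nikodym density, which is the derivative almost everywhere
   by Lebesgue's differentiation theorem. *)
From HB Require Import structures.
Require Import Defs.
From mathcomp Require Import measurable_realfun ring lra zify.

Set Implicit Arguments.
Unset Strict Implicit.
Unset Printing Implicit Defensive.

Import Order.TTheory GRing.Theory Num.Theory numFieldNormedType.Exports.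

Local Open Scope classical_set_scope.
Local Open Scope ring_scope.

(** * Absolute continuity and the fundamental theorem of calculus *)

Definition itv01 (R : realType) (p : R * R) :=
  [&& 0 <= p.1, p.1 <= p.2 & p.2 <= 1].

Definition itv_chain (R : realType) (l : seq (R * R)) :=
  pairwise (fun p q : R * R => p.2 <= q.1) l.

(* Absolute continuity on [0, 1], for lists of intervals ordered from left to
   right instead of finite disjoint families. *)
Definition ac_chain (R : realType) (g : R -> R) : Prop :=
  forall e : R, 0 < e -> exists2 d : R, 0 < d & forall l : seq (R * R),
    all (@itv01 R) l -> itv_chain l ->
    \sum_(p <- l) (p.2 - p.1) < d -> \sum_(p <- l) `|g p.2 - g p.1| <= e.

Section ac_chain_theory.
Context {R : realType}.
Implicit Types g : R -> R.

(** In a chain the open intervals are disjoint because each ends before the next begins. The strict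
    bound is weakened to [<=], the form that survives passing to suprema over partitions. *)
Lemma abs_continuous_ac_chain g : abs_continuous 0 1 g -> ac_chain g.
Proof.
move=> acg e e0; have [d d0 dP] := acg e e0; exists d => // l l01 cl ld.
pose p0 : R * R := (0, 0).
have := dP (size l) (fun i => (nth p0 l i).1) (fun i => (nth p0 l i).2) _ _ _.
rewrite !(big_nth p0) !big_mkord in ld *; move=> /(_ _ _ ld) H; apply/ltW/H.
  by move=> i; have /allP/(_ _ (mem_nth p0 (ltn_ord i)))/and3P[] := l01.
move=> i j _ _ [x [/=]]; rewrite !in_itv/= => /andP[a1 a2] /andP[b1 b2].
have /(pairwiseP p0) cP := cl.
apply/eqP/negPn/negP; rewrite -val_eqE neq_ltn => /orP[] ij.
  have := cP i j (ltn_ord i) (ltn_ord j) ij => h.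
  by have := lt_trans b1 (lt_le_trans a2 h); rewrite ltxx.
have := cP j i (ltn_ord j) (ltn_ord i) ij => h.
by have := lt_trans a1 (lt_le_trans b2 h); rewrite ltxx.
Qed.

Lemma ac_chainB g1 g2 : ac_chain g1 -> ac_chain g2 -> ac_chain (g1 \- g2).
Proof.
move=> ac1 ac2 e e0; have e20 : 0 < e / 2 by rewrite divr_gt0.
have [d1 d10 d1P] := ac1 _ e20; have [d2 d20 d2P] := ac2 _ e20.
exists (Num.min d1 d2); first by rewrite lt_min d10.
move=> l l01 cl; rewrite lt_min => /andP[ld1 ld2].
have := lerD (d1P l l01 cl ld1) (d2P l l01 cl ld2); rewrite -splitr.
apply: le_trans; rewrite -big_split/=; apply: ler_sum => p _.
by rewrite [X in `|X|](_ : _ =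
  (g1 p.2 - g1 p.1) - (g2 p.2 - g2 p.1)) ?ler_normB//; ring.
Qed.

Lemma ac_chain_sub g : ac_chain g -> forall e, 0 < e ->
  exists2 d, 0 < d & forall x y, 0 <= x -> x <= y -> y <= 1 -> y - x < d ->
    `|g y - g x| <= e.
Proof.
move=> acg e e0; have [d d0 dP] := acg e e0; exists d => // x y x0 xy y1 yxd.
have := dP [:: (x, y)]; rewrite !big_seq1 /= /itv01 /= x0 xy y1; exact.
Qed.

Lemma ac_chain_continuous g : ac_chain g -> {within `[0, 1], continuous g}.
Proof.
move=> acg; apply/subspace_continuousP => x /=;
  rewrite in_itv/= => /andP[x0 x1].
apply/cvgrPdist_le => e e0; have [d d0 dP] := ac_chain_sub acg e0.
rewrite near_withinE; near=> y; rewrite /= in_itv/= => /andP[y0 y1].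
have xyd : `|x - y| < d.
  near: y; exact: (@cvgr_dist_lt _ R _ _ _ id x).
have [xy|/ltW yx] := leP x y.
  by rewrite distrC; apply: dP => //; move: xyd;
    rewrite distrC ger0_norm// subr_ge0.
by apply: dP => //; move: xyd; rewrite ger0_norm// subr_ge0.
Unshelve. all: by end_near. Qed.

Definition partition_itvs (a : R) (s : seq R) : seq (R * R) :=
  zip (a :: s) s.

Lemma partition_itvs_cons a x s :
  partition_itvs a (x :: s) = (a, x) :: partition_itvs x s.
Proof. by []. Qed.

Lemma partition_itvs_bound a s : path <%R a s ->
  all (fun p : R * R => [&& a <= p.1, p.1 <= p.2 & p.2 <= last a s])
    (partition_itvs a s).
Proof.
elim: s a => // x s IH a /= /andP[ax xs].
have xl : x <= last x s.
  have : itv_partition x (last x s) s by split.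
  exact: itv_partition_le.
rewrite lexx (ltW ax) xl /=; apply/allP => p /(allP (IH _ xs)) /and3P[h1 h2 h3].
by rewrite h2 h3 (le_trans (ltW ax)).
Qed.

Lemma partition_itvs_chain a s : path <%R a s -> itv_chain (partition_itvs a s).
Proof.
elim: s a => // x s IH a /andP[ax xs].
rewrite partition_itvs_cons /itv_chain pairwise_cons; apply/andP; split;
  last exact: IH.
apply/allP => p; by move=> /(allP (partition_itvs_bound xs))/and3P[].
Qed.

Lemma partition_itvs_length a s :
  \sum_(p <- partition_itvs a s) (p.2 - p.1) = last a s - a.
Proof.
elim: s a => [|x s IH] a; first by rewrite big_nil subrr.
by rewrite partition_itvs_cons big_cons IH /=; ring.
Qed.

Lemma variation_partition_itvs a b g s : itv_partition a b s ->
  variation a b g s = \sum_(p <- partition_itvs a s) `|g p.2 - g p.1|.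
Proof.
move=> /variation_zip ->; rewrite /partition_itvs.
have -> : zip s (a :: s) = [seq (p.2, p.1) | p <- zip (a :: s) s].
  by elim: s a => //= x s IH c; rewrite -IH.
by rewrite big_map.
Qed.

(* On an interval of length less than the [d] given by [e = 1] the variation is
   at most [1]. *)
Lemma ac_chain_bounded_variation g : ac_chain g -> bounded_variation 0 1 g.
Proof.
move=> acg; have [d d0 dP] := acg 1 ltr01.
have small x y : 0 <= x -> x < y -> y <= 1 -> y - x < d ->
    bounded_variation x y g.
  move=> x0 xy y1 yxd; exists 1 => _ [s sxy <-].
  have [xs /eqP sy] := sxy.
  rewrite variation_partition_itvs//; apply: dP.
  - apply/allP => p /(allP (partition_itvs_bound xs))/and3P[h1 h2 h3].
    by rewrite /itv01 (le_trans x0)//= h2 (le_trans h3)// sy.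
  - exact: partition_itvs_chain.
  - by rewrite partition_itvs_length sy.
have [n n0 nd] : exists2 n : nat, (0 < n)%N & n%:R^-1 < d.
  exists (Num.truncn d^-1).+1 => //; rewrite invf_plt ?posrE//.
  exact: truncnS_gt.
have nR : 0 < n%:R :> R by rewrite ltr0n.
(* Cut [[0, 1]] into [n] intervals shorter than [d] and add up their finite variations. *)
have : forall m, (m <= n)%N -> (total_variation 0 (m%:R / n%:R) g < +oo)%E.
  elim=> [|m IH] mn; first by rewrite mul0r total_variationxx.
  have le1 : m%:R / n%:R <= m.+1%:R / n%:R :> R.
    by rewrite ler_pM2r ?invr_gt0// ler_nat.
  rewrite (total_variationD (c := m%:R / n%:R)) ?divr_ge0// lte_add_pinfty//.
    exact/IH/ltnW.
  have : bounded_variation (m%:R / n%:R) (m.+1%:R / n%:R) g.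
    apply: small.
    - by rewrite divr_ge0.
    - by rewrite ltr_pM2r ?invr_gt0// ltr_nat.
    - by rewrite ler_pdivrMr// mul1r ler_nat.
    - by rewrite -mulrBl -natrB// subSnn mul1r.
  by move/(bounded_variationP _ le1);
    rewrite ge0_fin_numE// total_variation_ge0.
move=> /(_ n (leqnn n)); rewrite divff ?gt_eqF// => h.
by apply/bounded_variationP => //; rewrite ge0_fin_numE// total_variation_ge0.
Qed.

End ac_chain_theory.

(** * The variation function of an absolutely continuous function *)

Section ac_chain_tv.
Context {R : realType}.
Implicit Types g : R -> R.

Lemma total_variation_fin_num g x y : ac_chain g -> 0 <= x -> x <= y ->
  y <= 1 ->
  total_variation x y g \is a fin_num.
Proof.
move=> acg x0 xy y1; apply/bounded_variationP => //.
apply: (bounded_variationr x0 xy);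
  apply: (bounded_variationl (le_trans x0 xy) y1).
exact: ac_chain_bounded_variation.
Qed.

Definition tv01 g (x : R) : R := fine (total_variation 0 x g).

Lemma tv01B g x y : ac_chain g -> 0 <= x -> x <= y -> y <= 1 ->
  tv01 g y - tv01 g x = fine (total_variation x y g).
Proof.
move=> acg x0 xy y1.
rewrite /tv01 (total_variationD _ x0 xy) fineD ?total_variation_fin_num//;
  first by ring.
exact: le_trans y1.
Qed.

(* The intervals are replaced one at a time by the intervals of an arbitrary
   partition, over which the supremum is then taken. *)
Lemma ac_chain_tv01 g : ac_chain g -> ac_chain (tv01 g).
Proof.
move=> acg e e0; have [d d0 dP] := acg e e0; exists d => // l l01 lc ld.
suff H pre : all (@itv01 R) (pre ++ l) -> itv_chain (pre ++ l) ->
    \sum_(p <- pre ++ l) (p.2 - p.1) < d ->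
    \sum_(p <- pre) `|g p.2 - g p.1| +
    \sum_(p <- l) fine (total_variation p.1 p.2 g) <= e.
  have := H [::] l01 lc ld; rewrite big_nil add0r; apply: le_trans.
  rewrite big_seq [leRHS]big_seq;
    apply: ler_sum => p /(allP l01) /and3P[p0 p12 p1].
  by rewrite tv01B// ger0_norm// fine_ge0// total_variation_ge0.
elim: l pre {l01 lc ld} => [|p l IH] pre.
  by rewrite cats0 big_nil addr0; exact: dP.
rewrite all_cat /= => /and3P[pre01 p01 l01].
rewrite /itv_chain pairwise_cat allrel_consr => /and3P[/andP[prep prel] cpre].
rewrite pairwise_cons => /andP[pl cl].
rewrite big_cat big_cons /= => ld; rewrite big_cons.
have /and3P[p0 p12 p1] := p01.
rewrite addrCA -lerBrDr -lee_fin fineK ?total_variation_fin_num//.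
apply: ge_ereal_sup => _ [_ [s sp <-] <-]; rewrite lee_fin lerBrDr.
have [ps /eqP lastp] := sp; rewrite variation_partition_itvs//.
have bs := partition_itvs_bound ps; rewrite lastp in bs.
rewrite addrCA; have := IH (pre ++ partition_itvs p.1 s).
rewrite [X in _ -> _ -> _ -> X + _ <= _]big_cat /= -addrA; apply.
- rewrite !all_cat pre01 l01 andbT; apply/allP => q /(allP bs)/and3P[h1 h2 h3].
  by rewrite /itv01 (le_trans p0)//= h2 (le_trans h3).
- rewrite /itv_chain !pairwise_cat allrel_catl cpre cl prel.
  rewrite (partition_itvs_chain ps : pairwise _ _) /= !andbT; apply/andP; split.
    apply/allrelP => q q' /(allP bs)/and3P[h1 h2 h3] q'l.
    by rewrite (le_trans h3)//; have /allP := pl; exact.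
  apply/allrelP => q q' qpre /(allP bs)/and3P[h1 h2 h3].
  by apply: le_trans h1; have /allP := prep; exact.
- by rewrite !big_cat /= partition_itvs_length lastp -addrA.
Qed.

Lemma tv01_nondecreasing g : ac_chain g ->
  {in `[0, 1] &, nondecreasing_fun (tv01 g)}.
Proof.
move=> acg x y; rewrite !in_itv/= => /andP[x0 x1] /andP[y0 y1] xy.
by rewrite -subr_ge0 tv01B// fine_ge0// total_variation_ge0.
Qed.

(** An increment of [g] is at most its variation over the same interval. This completes the Jordan
    decomposition of [g] into a difference of nondecreasing functions. *)
Lemma tv01B_nondecreasing g : ac_chain g ->
  {in `[0, 1] &, nondecreasing_fun (tv01 g \- g)}.
Proof.
move=> acg x y; rewrite !in_itv/= => /andP[x0 x1] /andP[y0 y1] xy.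
rewrite -subr_ge0 opprB addrA [X in 0 <= X](_ : _ =
  (tv01 g y - tv01 g x) - (g y - g x)).
  rewrite tv01B// subr_ge0 -lee_fin fineK ?total_variation_fin_num//.
  apply: le_trans (total_variation_ge _ xy); rewrite lee_fin; exact: ler_norm.
by ring.
Qed.

End ac_chain_tv.

(** * Finite unions of intervals and dyadic approximation of open sets from inside *)

Section oc_union.
Context {R : realType}.
Implicit Types (l : seq (R * R)) (U : set R).
Local Notation mu := lebesgue_measure.

(** Half-open intervals keep neighbours with a common endpoint disjoint, and Stieltjes measures are
    given on them by increments. *)
Definition oc_union l : set R := \big[setU/set0]_(p <- l) `]p.1, p.2]%classic.

Lemma oc_unionP l x : oc_union l x <-> exists2 p, p \in l & p.1 < x <= p.2.
Proof.
rewrite /oc_union; elim: l => [|p l IH].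
  by rewrite big_nil; split => // -[p].
rewrite big_cons; split.
  case => [px|/IH[q ql qx]].
    by exists p; [rewrite mem_head|move: px; rewrite /= in_itv].
  by exists q => //; rewrite inE ql orbT.
case=> q; rewrite inE => /predU1P[->|ql] qx.
  by left; rewrite /= in_itv.
by right; apply/IH; exists q.
Qed.

Lemma measurable_oc_union l : measurable (oc_union l).
Proof. by apply: bigsetU_measurable => p _; exact: measurable_itv. Qed.

Lemma oc_union_le (nu : {measure set (measurableTypeR R) -> \bar R}) l :
  (nu (oc_union l) <= \sum_(p <- l) nu `]p.1, p.2]%classic)%E.
Proof.
rewrite /oc_union; elim: l => [|p l IH]; first by rewrite !big_nil measure0.
rewrite !big_cons; apply: (le_trans (measureU2 _ _ _)) => //.
- exact: (measurable_oc_union l).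
- exact: leeD2l.
Qed.

Lemma lebesgue_oc_union l : all (@itv01 R) l -> itv_chain l ->
  mu (oc_union l) = (\sum_(p <- l) (p.2 - p.1))%:E.
Proof.
rewrite /oc_union; elim: l => [|p l IH]; first by rewrite !big_nil measure0.
move=> /= /andP[/and3P[p0 p12 p1] l01]; move=> /andP[/allP pl cl].
rewrite !big_cons EFinD -IH//.
rewrite measureU//=.
- congr (_ + _)%E; rewrite lebesgue_measure_itv /= lte_fin.
  by case: ltgtP p12 => //= ->; rewrite subrr.
- exact: (measurable_oc_union l).
- rewrite -subset0 => x [] /=; rewrite in_itv/= => /andP[_ xp].
  move=> /oc_unionP[q /pl h /andP[qx _]].
  by have := lt_le_trans qx (le_trans xp h); rewrite ltxx.
Qed.

Definition dyadic_itv (n j : nat) : R * R := (j%:R / 2 ^+ n, j.+1%:R / 2 ^+ n).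

(** These finite chains exhaust the part of an open set [U] in []0, 1]] as [n] grows, so that
    absolute continuity, a statement on finite chains, reaches open sets. *)
Definition dyadic_inner U n : seq (R * R) :=
  [seq dyadic_itv n j | j <- iota 0 (2 ^ n) &
    `[< `](dyadic_itv n j).1, (dyadic_itv n j).2]%classic `<=` U >]].

Lemma dyadic_inner_itv01 U n : all (@itv01 R) (dyadic_inner U n).
Proof.
apply/allP => _ /mapP[j /[!(mem_filter, mem_iota)] /andP[_ /= jn] ->].
have n0 : 0 < 2 ^+ n :> R by rewrite exprn_gt0.
rewrite /itv01 /= divr_ge0 ?(ltW n0)//= ler_pM2r ?invr_gt0// ler_nat leqnSn /=.
by rewrite ler_pdivrMr// mul1r -natrX ler_nat.
Qed.

Lemma dyadic_inner_chain U n : itv_chain (dyadic_inner U n).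
Proof.
rewrite /itv_chain /dyadic_inner pairwise_map.
apply: (@sub_pairwise _ ltn); last first.
  rewrite -(sorted_pairwise ltn_trans).
  by apply: sorted_filter; [exact: ltn_trans|exact: iota_ltn_sorted].
by move=> i j ij /=; rewrite ler_pM2r ?ler_nat// invr_gt0 exprn_gt0.
Qed.

Lemma dyadic_inner_sub U n : oc_union (dyadic_inner U n) `<=` U.
Proof.
move=> x /oc_unionP[_ /mapP[j /[!mem_filter] /andP[/asboolP jU _] ->] xj].
by apply: jU; rewrite /= in_itv.
Qed.

Lemma mem_dyadic_inner U n j x : (j < 2 ^ n)%N ->
  `](dyadic_itv n j).1, (dyadic_itv n j).2]%classic `<=` U ->
  j%:R / 2 ^+ n < x <= j.+1%:R / 2 ^+ n -> oc_union (dyadic_inner U n) x.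
Proof.
move=> jn jU xj; apply/oc_unionP; exists (dyadic_itv n j) => //.
by apply: map_f; rewrite mem_filter mem_iota /= jn andbT; exact/asboolP.
Qed.

(** Each dyadic interval is the union of its two halves, which belong to the next level. *)
Lemma dyadic_inner_nondecreasing U :
  nondecreasing_seq (fun n => oc_union (dyadic_inner U n)).
Proof.
apply/nondecreasing_seqP => n; apply/subsetPset => x.
move=> /oc_unionP[_ /mapP[j + ->]] /=.
rewrite mem_filter mem_iota /= => /andP[/asboolP jU jn] /andP[jx xj].
have n0 : 0 < 2 ^+ n :> R by rewrite exprn_gt0.
have e1 : j%:R / 2 ^+ n = (2 * j)%:R / 2 ^+ n.+1 :> R.
  by rewrite exprS natrM; field; rewrite gt_eqF.
have e2 : j.+1%:R / 2 ^+ n = (2 * j).+2%:R / 2 ^+ n.+1 :> R.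
  by rewrite exprS (_ : (2 * j).+2 = 2 * j.+1)%N ?natrM; [field;
    rewrite gt_eqF|lia].
have le12 (a b : nat) : (a <= b)%N -> a%:R / 2 ^+ n.+1 <= b%:R / 2 ^+ n.+1 :> R.
  by move=> ab; rewrite ler_pM2r ?ler_nat// invr_gt0 exprn_gt0.
have [xm|xm] := leP x ((2 * j).+1%:R / 2 ^+ n.+1).
  apply: (@mem_dyadic_inner _ _ (2 * j)%N); rewrite ?expnS; [lia| |].
    move=> y; rewrite /= in_itv/= => /andP[y1 y2]; apply: jU.
    by rewrite /= in_itv/= e1 y1 e2 (le_trans y2)// le12.
  by rewrite -e1 jx.
apply: (@mem_dyadic_inner _ _ (2 * j).+1%N); rewrite ?expnS; [lia| |].
  move=> y; rewrite /= in_itv/= => /andP[y1 y2]; apply: jU.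
  by rewrite /= in_itv/= e2 y2 andbT e1 (le_lt_trans _ y1)// le12.
by rewrite -e2 xm.
Qed.

Lemma dyadic_inner_cover U x : open U -> U x -> 0 < x -> x <= 1 ->
  exists n, oc_union (dyadic_inner U n) x.
Proof.
move=> oU Ux x0 x1; have /nbhs_ballP[e /= e0 eU] := open_nbhs_nbhs (conj oU Ux).
(* With [1 / e < n <= 2 ^ n], a dyadic interval of level [n] containing [x] stays in the ball of
   radius [e]. *)
pose n := (Num.truncn e^-1).+1.
have n0 : 0 < 2 ^+ n :> R by rewrite exprn_gt0.
have ne : (2 ^+ n)^-1 < e.
  rewrite invf_plt ?posrE//; apply: (lt_le_trans (truncnS_gt _)).
  by rewrite -natrX ler_nat ltnW// ltn_expl.
exists n.
(* The intervals are open on the left, so the right endpoint comes from the least integer not below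
   [x * 2 ^+ n]; it is nonzero since [x] is positive. *)
have ex : exists m, (x * 2 ^+ n <= m%:R).
  by exists (Num.truncn (x * 2 ^+ n)).+1; rewrite ltW// truncnS_gt.
case: (ex_minnP ex) => -[|j] jx jmin.
  by move: jx; rewrite leNgt mulr_gt0.
have jx' : j%:R < x * 2 ^+ n.
  by rewrite ltNge; apply/negP => /jmin; rewrite ltnn.
apply: (@mem_dyadic_inner _ _ j).
- rewrite -(ltr_nat R) natrX (lt_le_trans jx')// -[leRHS]mul1r ler_pM2r//.
- move=> y; rewrite /= in_itv/= => /andP[];
    rewrite ltr_pdivrMr// ler_pdivlMr// => y1 y2.
  have jS : j.+1%:R = j%:R + 1 :> R by rewrite -natr1.
  rewrite jS in y2 jx.
  apply: eU => /=.
  have d1 : `|x - y| * 2 ^+ n < 1.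
    rewrite -[X in _ * X]gtr0_norm// -normrM mulrBl ltr_norml; apply/andP;
      split; lra.
  by apply: lt_trans ne; rewrite -[ltRHS]mul1r ltr_pdivlMr.
- by rewrite ltr_pdivrMr// jx' ler_pdivlMr.
Qed.

End oc_union.

(** * Densities of monotone absolutely continuous functions *)

Section density.
Context {R : realType}.
Local Notation mu := lebesgue_measure.

(** Composition with this retraction extends a function on [[0, 1]] by constants, as a cumulative
    function on the whole line requires. *)
Definition clamp01 (x : R) : R := Num.max 0 (Num.min x 1).

Lemma clamp01_itv x : 0 <= clamp01 x <= 1.
Proof. by rewrite /clamp01 le_max lexx ge_max ge_min ler01 lexx orbT. Qed.

Lemma clamp01_id x : 0 <= x <= 1 -> clamp01 x = x.
Proof. by move=> /andP[x0 x1]; rewrite /clamp01 min_l// max_r. Qed.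

Lemma clamp01_homo : {homo clamp01 : x y / x <= y}.
Proof.
move=> x y xy; rewrite /clamp01 ge_max !le_max lexx/=; apply/orP; right.
by rewrite le_min !ge_min xy lexx orbT.
Qed.

Lemma clamp01_lipschitz x y : x <= y -> clamp01 y - clamp01 x <= y - x.
Proof.
by move=> xy; rewrite /clamp01 !maxEle !minEle; do ![case: ifPn];
  rewrite -?ltNge; lra.
Qed.

Lemma ac_chain_clamp_continuous (h : R -> R) : ac_chain h ->
  continuous (h \o clamp01).
Proof.
move=> ach x; apply/cvgrPdist_le => e e0; have [d d0 dP] := ac_chain_sub ach e0.
near=> y => /=.
have xyd : `|x - y| < d.
  near: y; exact: (@cvgr_dist_lt _ R _ _ _ id x).
have H u v : u <= v -> `|u - v| < d -> `|h (clamp01 v) - h (clamp01 u)| <= e.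
  move=> uv; rewrite distrC ger0_norm ?subr_ge0// => uvd.
  have /andP[u0 u1] := clamp01_itv u; have /andP[v0 v1] := clamp01_itv v.
  by apply: dP => //; [exact: clamp01_homo|exact: le_lt_trans
    (clamp01_lipschitz uv) _].
have [xy|/ltW yx] := leP x y; first by rewrite distrC; exact: H.
by apply: H => //; rewrite distrC.
Unshelve. all: by end_near. Qed.

Lemma lebesgue_stieltjes_oc (P : cumulative R R) x y : x <= y ->
  lebesgue_stieltjes_measure P `]x, y]%classic = (P y - P x)%:E.
Proof.
move=> xy; rewrite /lebesgue_stieltjes_measure /measure_extension.
by rewrite measurable_mu_extE/=; [rewrite wlength_itv_bnd|exact: is_ocitv].
Qed.

(** A Lebesgue null set lies in an open set of small measure. Absolute continuity makes the
    Stieltjes measure of every dyadic inner approximation of that open set small, so the Stieltjes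
    measure is dominated by Lebesgue measure and Radon-Nikodym yields [phi]. *)
Lemma ac_density (h : R -> R) : {in `[0, 1] &, nondecreasing_fun h} ->
  ac_chain h ->
  exists2 phi : R -> R, mu.-integrable setT (EFin \o phi) &
    forall x, 0 <= x <= 1 -> h x - h 0 = Rintegral mu `[0, x] phi.
Proof.
move=> ndh ach.
have P_nd : nondecreasing (h \o clamp01).
  move=> x y xy /=; apply: ndh; rewrite ?in_itv ?clamp01_itv//.
  exact: clamp01_homo.
have P_rc : right_continuous (h \o clamp01).
  by apply: right_continuousW; exact: ac_chain_clamp_continuous.
pose P : cumulative R R :=
  HB.pack (h \o clamp01) (isCumulative.Build _ _ _ _ P_nd P_rc).
have PE x y : 0 <= x -> x <= y -> y <= 1 ->
    lebesgue_stieltjes_measure P `]x, y]%classic = (h y - h x)%:E.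
  move=> x0 xy y1; rewrite lebesgue_stieltjes_oc//= !clamp01_id// ?x0 ?y1
    ?andbT//.
  - exact: le_trans xy y1.
  - exact: le_trans x0 xy.
have mI : measurable (`]0,
  1]%classic : set (measurableTypeR R)) by exact: measurable_itv.
have finI : (lebesgue_stieltjes_measure P `]0%R, 1%R]%classic < +oo)%E.
  by rewrite PE// ltry.
pose nu : {finite_measure set (measurableTypeR R) -> \bar R} := mfrestr mI finI.
have numu : nu `<< (mu : {measure set (measurableTypeR R) -> \bar R}).
  apply/null_content_dominatesP => A mA muA0.
  have mD : measurable (A `&` `]0, 1]%classic) by exact: measurableI.
  have muD0 : mu (A `&` `]0, 1]%classic) = 0%E.
    by apply: (@subset_measure0 _ _ _ mu _ A) => //; exact: subIsetl.
  apply/eqP; rewrite eq_le measure_ge0 andbT; apply/lee_addgt0Pr => e e0.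
  rewrite add0e; have [d d0 dP] := ach e e0.
  have muDy : (mu (A `&` `]0%R, 1%R]%classic) < +oo)%E by rewrite muD0 ltry.
  (* Regularity bounds only the measure of [U] minus the null set, which is the measure of [U]
     itself. *)
  have [U [oU DU UD]] := lebesgue_regularity_outer mD muDy d0.
  have mU : measurable U by exact: open_measurable.
  have muU : (mu U < d%:E)%E.
    apply: le_lt_trans UD; rewrite -[X in (mu X <= _)%E](setDUK DU).
    by rewrite -[leRHS]add0e -muD0; apply: measureU2 => //; exact: measurableD.
  have Fe n : (lebesgue_stieltjes_measure P (oc_union (dyadic_inner U n)) <=
    e%:E)%E.
    apply: (le_trans (oc_union_le _ _)).
    have H01 := dyadic_inner_itv01 U n; have Hc := dyadic_inner_chain U n.
    rewrite big_seq (eq_bigr (fun p => (h p.2 - h p.1)%:E)); last first.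
      by move=> p /(allP H01)/and3P[p0 p12 p1]; exact: PE.
    rewrite -big_seq sumEFin lee_fin.
    apply: (le_trans (ler_sum _ (fun p _ => ler_norm _))); apply: dP => //.
    rewrite -lte_fin -lebesgue_oc_union//; apply: le_lt_trans muU.
    apply: le_measure; rewrite ?inE//; first exact: measurable_oc_union.
    exact: dyadic_inner_sub.
  have mF n : measurable (oc_union (dyadic_inner U n)) by exact:
    measurable_oc_union.
  have mbF : measurable (\bigcup_n oc_union (dyadic_inner U n)).
    exact: bigcup_measurable.
  (* Continuity from below carries the uniform bound [e] over to the union of all levels. *)
  have Fcvg := nondecreasing_cvg_mu (mu := lebesgue_stieltjes_measure P) mF mbF
    (@dyadic_inner_nondecreasing _ U).
  have : (lebesgue_stieltjes_measure P (\bigcup_n oc_union (dyadic_inner U n))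
    <= e%:E)%E.
    rewrite -(cvg_lim _ Fcvg)//; apply: lime_le.
      by apply/cvg_ex; eexists; exact: Fcvg.
    by apply: nearW => n; exact: Fe.
  apply: le_trans; apply: le_measure; rewrite ?inE//.
  move=> x [Ax]; rewrite /= in_itv/= => /andP[x0 x1].
  have Ux : U x by apply: DU; split => //; rewrite /= in_itv/= x0.
  by have [n nx] := dyadic_inner_cover oU Ux x0 x1; exists n.
have [f [f0 ffin fint fE]] := radon_nikodym_sigma_finite numu.
have phi_int : mu.-integrable setT (EFin \o (fine \o f)).
  by rewrite [X in integrable _ _ X](_ : _ = f)//; apply/funext => x /=;
    rewrite fineK.
exists (fine \o f) => //.
move=> x /andP[x0 x1].
rewrite -Rintegral_itv_obnd_cbnd; last first.
  exact: integrableS phi_int.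
rewrite /Rintegral; under eq_integral do rewrite /= fineK//.
rewrite -fE//= /mfrestr /mrestr setIidl ?PE//.
by apply: subset_itvl; rewrite bnd_simp.
Qed.

End density.

(** * Lebesgue's fundamental theorem of calculus *)

Section ftc_ac.
Context {R : realType}.
Local Notation mu := lebesgue_measure.

(** At an interior point [[0, 1]] is a neighbourhood, so the restricted punctured filter is the
    ordinary one. *)
Lemma derive01_interior (g : R -> R) (x l : R) : 0 < x < 1 ->
  (fun y => (g y - g x) / (y - x)) @ x^' --> l -> derive01 g x = l.
Proof.
move=> /andP[x0 x1] gl; rewrite /derive01 /diff_quot01.
suff -> : within `[0, 1]%classic x^' = x^' by exact: cvg_lim gl.
have I01 : \forall y \near x^', `[0, 1]%classic y.
  have /near_in_itvoo x01 : x \in `]0, 1[ by rewrite in_itv/= x0.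
  by apply: cvg_within; apply: filterS x01 => y;
    rewrite /= !in_itv/= => /andP[/ltW-> /ltW->].
apply/seteqP; split => A; last exact: cvg_within.
by move=> wA; apply: filterS2 I01 wA => y ? /(_ _); apply.
Qed.

(** The densities of [tv01 g] and [tv01 g \- g] differ by a density [phi] of [g], and Lebesgue's
    differentiation theorem identifies [phi] with [derive01 g] almost everywhere. *)
Lemma ac_chain_FTC (g : R -> R) : ac_chain g ->
  mu.-integrable `[0, 1] (EFin \o derive01 g) ->
  forall x, 0 <= x <= 1 -> g x - g 0 = Rintegral mu `[0, x] (derive01 g).
Proof.
move=> acg dgi.
have acV := ac_chain_tv01 acg; have acN := ac_chainB acV acg.
have [phi1 phi1i phi1E] := ac_density (tv01_nondecreasing acg) acV.
have [phi2 phi2i phi2E] := ac_density (tv01B_nondecreasing acg) acN.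
pose phi := phi1 \- phi2.
have phii : mu.-integrable setT (EFin \o phi).
  by rewrite [X in integrable _ _ X](_ : _ =
    (EFin \o phi1) \- (EFin \o phi2))%E//;
    exact: integrableB.
have phiiS (D : set R) : measurable D -> mu.-integrable D (EFin \o phi).
  by move=> mD; exact: integrableS phii.
pose F (y : R) := Rintegral mu `[0, y] phi.
have phiE x : 0 <= x <= 1 -> g x - g 0 = F x.
  move=> x01; rewrite /F RintegralB//;
    [|exact: integrableS phi1i|exact: integrableS phi2i].
  by rewrite -phi1E// -phi2E//=; ring.
have locphi : locally_integrable setT phi.
  split; [|exact: openT|].
    by move/integrableP : phii => [/measurable_EFinP].
  move=> K _ cK.
  have mK : measurable K by exact: compact_measurable.
  by have /integrableP[] := phiiS _ mK.
have aeF := FTC1 (a := BLeft 0) (fun y => phiiS _ (measurable_itv _)) locphi.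
have {aeF} aeD : {ae mu, forall x, 0 < x < 1 -> derive01 g x = phi x}.
  move: aeF; apply: filterS; first exact: (ae_filter_ringOfSetsType mu).
  move=> x H /andP[x0 x1].
  have [dF dFE] : derivable F x 1 /\ derive1 F x = phi x by apply: H;
    rewrite lte_fin.
  apply: derive01_interior; first by rewrite x0.
  have Fl : (fun h => h^-1 *: (F (h + x) - F x)) @ 0^' --> phi x.
    rewrite -dFE; move: dF; rewrite /derivable /derive1.
    set u := (X in cvg (X @ _) -> _); set v := (X in _ -> X @ _ --> _).
    suff -> : u = v by [].
    by apply/funext => h; rewrite /u /v /= [h *: 1]mulr1.
  (* Within this ball the points stay in [[0, 1]], where [g] and [F] differ by a constant and hence
     have the same difference quotients. *)
  have /near_in_itvoo /nbhs_ballP[d /= d0 dx] : x \in `]0,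
    1[ by rewrite in_itv/= x0.
  apply/cvgrPdist_lt => e e0.
  have /cvgrPdist_lt/(_ e e0)/nbhs_ballP[d' /= d'0 d'P] := Fl.
  apply/nbhs_ballP; exists (Num.min d d') => /=; first by rewrite lt_min d0.
  move=> y; rewrite -ball_normE /= lt_min => /andP[yd yd'] yx.
  have := dx y yd; rewrite in_itv/= => /andP[/ltW y0 /ltW y1].
  have := d'P (y - x); rewrite -ball_normE /= sub0r normrN distrC subrK
    subr_eq0 yd'.
  move=> /(_ isT yx); rewrite -!phiE ?y0 ?(ltW x0) ?(ltW x1)// => gy.
  rewrite [X in `|_ - X|](_ : _ = (y - x)^-1 *: (g y - g 0 - (g x - g 0))).
  exact: gy.
  by rewrite /GRing.scale /= [RHS]mulrC; congr (_ * _); ring.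
move=> x /andP[x0 x1]; rewrite phiE ?x0// /F.
have dgx : mu.-integrable `[0, x] (EFin \o derive01 g).
  by apply: integrableS dgi => //; apply: subset_itvl; rewrite bnd_simp.
have phix := phiiS _ (measurable_itv `[0, x]).
have oc : `]0, x[ `<=` `[0, x] by apply: subset_itv_oo_cc.
(* The endpoints are dropped because the almost everywhere equality concerns interior points. *)
rewrite -[LHS]Rintegral_itv_obnd_cbnd -?[LHS]Rintegral_itv_bndo_bndc;
  last 2 first.
- by apply: integrableS phix.
- by apply: integrableS phix => //; apply: subset_itvr; rewrite bnd_simp.
rewrite -[RHS]Rintegral_itv_obnd_cbnd -?[RHS]Rintegral_itv_bndo_bndc;
  last 2 first.
- by apply: integrableS dgx.
- by apply: integrableS dgx => //; apply: subset_itvr; rewrite bnd_simp.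
rewrite /Rintegral; congr fine; apply: ae_eq_integral => //.
- by have /integrableP[] : mu.-integrable `]0,
    x[ (EFin \o phi) by exact: integrableS phix.
- by have /integrableP[] : mu.-integrable `]0,
    x[ (EFin \o derive01 g) by exact: integrableS dgx.
move: aeD; apply: filterS; first exact: (ae_filter_ringOfSetsType mu).
move=> y yP /=; rewrite in_itv/= => /andP[y0 yx]; congr EFin; apply/esym/yP;
  rewrite y0/=.
exact: lt_le_trans yx x1.
Qed.

End ftc_ac.

(** * Digits and the weights mu *)

Section digits.
Variable b : nat.
Hypothesis hb : (2 <= b)%N.

Lemma nat_digit_addmul a c k m : (0 < a)%N -> (0 < c)%N -> (k < b ^ a.-1)%N ->
  (m < b)%N ->
  nat_digit b (m * b ^ a.-1 + k) c =
  if (c < a)%N then nat_digit b k c else if c == a then m else 0%N.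
Proof.
move=> a0 c0 ka mb; rewrite /nat_digit.
have b0 : (0 < b)%N by lia.
have bn0 n : (0 < b ^ n)%N by rewrite expn_gt0 b0.
case: ltnP => [ca|ac].
  have -> : (b ^ a.-1 = b ^ (a.-1 - c) * b * b ^ c.-1)%N.
    by rewrite -expnSr -expnD; congr expn; lia.
  by rewrite mulnA divnMDl// mulnA modnMDl.
have [->|ca] := eqVneq c a.
  by rewrite divnMDl// divn_small// addn0 modn_small.
rewrite divn_small ?mod0n//.
have : (m * b ^ a.-1 + k < b * b ^ a.-1)%N by nia.
rewrite -expnS => /leq_trans; apply; apply: leq_pexp2l => //; lia.
Qed.

Lemma mem_digit_pos k a :
  (a \in digit_pos b k) = (0 < a)%N && (nat_digit b k a != 0%N).
Proof.
rewrite mem_filter mem_rev mem_iota andbC add1n ltnS.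
case: (posnP a) => [->|a0]//=; case: eqVneq => [|d0]; rewrite ?andbF ?andbT//=.
rewrite leqNgt; apply/negP => ka; move: d0;
  rewrite /nat_digit divn_small ?mod0n//.
apply: (leq_trans (ltn_expl k (leq_trans _ hb))) => //.
by apply: leq_pexp2l; lia.
Qed.

(** Both sides are strictly decreasing lists with the same members. *)
Lemma digit_pos_cons a m k : (0 < a)%N -> (k < b ^ a.-1)%N -> (0 < m < b)%N ->
  digit_pos b (m * b ^ a.-1 + k) = a :: digit_pos b k.
Proof.
move=> a0 ka /andP[m0 mb].
have lt_a c : c \in digit_pos b k -> (c < a)%N.
  rewrite mem_digit_pos => /andP[c0]; apply: contraR; rewrite -leqNgt => ac.
  rewrite /nat_digit divn_small ?mod0n//; apply: (leq_trans ka).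
  by apply: leq_pexp2l; lia.
apply: (@irr_sorted_eq _ gtn).
- by move=> x y z /= xy yz; exact: ltn_trans yz xy.
- by move=> x /=; rewrite ltnn.
- exact: digit_pos_sorted.
- have := digit_pos_sorted b k; case: (digit_pos b k) lt_a => //= c l lt_a ->.
  by rewrite lt_a ?mem_head.
- move=> c; rewrite inE !mem_digit_pos; case: (posnP c) => [->|c0] /=.
    by rewrite orbF; lia.
  rewrite nat_digit_addmul//; case: ltngtP => [ca|ac|->] //=; last by lia.
  apply/esym/negbTE; rewrite negbK /nat_digit divn_small ?mod0n//.
  by apply: (leq_trans ka); apply: leq_pexp2l; lia.
Qed.

Lemma nat_top_digit k : (0 < k)%N ->
  exists a m k', [/\ (0 < a)%N, (0 < m < b)%N,
  (k' < b ^ a.-1)%N & k = (m * b ^ a.-1 + k')%N].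
Proof.
move=> k0; pose n := trunc_log b k.
exists n.+1, (k %/ b ^ n)%N, (k %% b ^ n)%N.
have b0 : (0 < b ^ n)%N by rewrite expn_gt0; lia.
have /andP[n1 n2] := trunc_log_bounds hb k0.
split => //=; first by rewrite divn_gt0// n1 ltn_divLR// -expnS.
- by rewrite ltn_mod.
- exact: divn_eq.
Qed.

End digits.

(** * The weight mu on lists of digit positions *)

Definition mu_seq (r : nat) (l : seq nat) : nat :=
  if (r == 0%N) || (l == [::]) then 0%N
  else if (size l < r)%N then (sumn l + (r - size l) * last 0 l)%N
  else sumn (take r l).

Lemma mu_perE b r k : (2 <= b)%N -> mu_per b r k = mu_seq r (digit_pos b k).
Proof.
move=> hb; rewrite /mu_per /mu_seq /num_digits; case: (r == 0%N) => //=.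
case: (posnP k) => [->|k0]//=.
have [a [m [k' [a0 mb kb ->]]]] := nat_top_digit hb k0.
by rewrite digit_pos_cons// gt_eqF// (leq_trans _ (leq_addr _ _))// muln_gt0;
  case/andP: mb => -> _; rewrite expn_gt0; lia.
Qed.

(** One order is spent on the leading position; if it is also the last, it is counted again for each
    remaining order. *)
Lemma mu_seq_cons r a l :
  mu_seq r.+1 (a :: l) = (a + (if l == [::] then r * a else mu_seq r l))%N.
Proof.
rewrite /mu_seq /= ltnS; case: l => [|c l] /=.
  by case: r => [|r] //=; rewrite ?addn0 ?mul0n; lia.
by case: r => [|r] /=; last by rewrite ltnS !subSS; case: ifP => // _;
  rewrite !addnA.
Qed.

Lemma mu_seq1 r a : mu_seq r [:: a] = (r * a)%N.
Proof. by case: r => // r; rewrite mu_seq_cons eqxx mulSn. Qed.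

(** Meant for terms with an additional leading digit: by [mu_seq_cons] it says that the weight of
    order [r.+1] at [(a + c) :: a :: l] exceeds that at [l] by at least [c + 1]. *)
Lemma mu_seq_gain (r a : nat) (l : seq nat) : l != [::] ->
  sorted gtn (a :: l) ->
  (mu_seq r.+1 l < a + mu_seq r (a :: l))%N.
Proof.
elim: r a l => [|r IH] a [|c l] // _ /= /andP[/= ca cl].
  by rewrite mu_seq_cons /mu_seq /=; case: ifP; rewrite ?mul0n; lia.
rewrite mu_seq_cons mu_seq_cons.
have [->|l0] := eqVneq l [::]; first by rewrite /= mu_seq1; nia.
rewrite /=; have := IH c l l0 cl; lia.
Qed.

(** Both sides add [r.+1] positions, the last one being repeated if necessary. Prefixing [a] shifts
    the list, so the sums compare term by term, strictly in the first term. *)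
Lemma mu_seq_lt (r a : nat) (l : seq nat) : l != [::] -> sorted gtn (a :: l) ->
  (mu_seq r.+1 l < mu_seq r.+1 (a :: l))%N.
Proof.
elim: r a l => [|r IH] a [|c l] // _ /= /andP[/= ca cl].
  by rewrite !mu_seq_cons /mu_seq /=; case: ifP; rewrite ?mul0n; lia.
rewrite [X in (_ < X)%N]mu_seq_cons /= mu_seq_cons.
have [->|l0] := eqVneq l [::]; first by rewrite /= mu_seq1; nia.
rewrite /=; have := IH c l l0 cl; lia.
Qed.

(** * Propagation of the bounds through the recursion *)

Section coefficient_bounds.
Context {R : realType}.
Variables (b : nat) (S : R).
Hypotheses (hb : (2 <= b)%N) (S0 : 0 < S).

Let B : R := b%:R.
Let B2 : 2 <= B. Proof. by rewrite /B ler_nat. Qed.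
Let B0 : 0 < B. Proof. exact: lt_le_trans B2. Qed.

Definition growth : R := 1 + 1 / B + 1 / (B * (B + 1)).

(** The empty list stands for index 0. It gets weight zero because the coefficient there is a mean,
    which enters the bound as a separate term. *)
Definition mu_weight (r : nat) (l : seq nat) : R :=
  if l == [::] then 0 else B ^- mu_seq r l.

(* Recursion for Walsh coefficients: if [F] bounds those of f', as a function of
   the digit positions, then, up to a term vanishing as [N] grows, this bounds
   those of f at an index with digit positions [a :: l]. *)
Definition walsh_step (F : seq nat -> R) (N a : nat) (l : seq nat) : R :=
  B ^- a / S * (F l + F (a :: l) +
    \sum_(1 <= c < N.+1) (B - 1) * B ^- c * F ((a + c)%N :: a :: l)).

Let eq_le_refl (x y : R) : x = y -> x <= y. Proof. by move->. Qed.

Lemma mu_weight_ge0 r l : 0 <= mu_weight r l.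
Proof. by rewrite /mu_weight; case: ifP => // _;
  rewrite invr_ge0 exprn_ge0// ltW. Qed.

Lemma walsh_stepZ F x N a l :
  walsh_step (fun l => x * F l) N a l = x * walsh_step F N a l.
Proof.
rewrite /walsh_step [RHS]mulrCA; congr (_ * _); rewrite !mulrDr; congr (_ + _).
by rewrite mulr_sumr; apply: eq_bigr => c _; ring.
Qed.

Lemma walsh_step_le F G N a l : (forall l, F l <= G l) ->
  walsh_step F N a l <= walsh_step G N a l.
Proof.
move=> FG; rewrite /walsh_step ler_wpM2l//.
  by rewrite divr_ge0 ?invr_ge0 ?exprn_ge0 ?(ltW B0) ?(ltW S0).
rewrite !lerD//; apply: ler_sum => c _; rewrite ler_wpM2l// mulr_ge0//.
  by have := B2; lra.
by rewrite invr_ge0 exprn_ge0 ?(ltW B0).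
Qed.

Lemma sum_geom N : \sum_(1 <= c < N.+1) (B - 1) * B ^- c <= 1.
Proof.
suff -> : \sum_(1 <= c < N.+1) (B - 1) * B ^- c = 1 - B ^- N.
  by rewrite gerBl invr_ge0 exprn_ge0// (ltW B0).
elim: N => [|N IH]; first by rewrite big_geq// expr0 invr1 subrr.
rewrite big_nat_recr//= IH exprS; field.
by rewrite expf_neq0 ?gt_eqF.
Qed.

Lemma sum_geom2 N :
  \sum_(1 <= c < N.+1) (B - 1) * (B ^- c * B ^- c) <= 1 / (B + 1).
Proof.
have B1 : 0 < B + 1 by rewrite addr_gt0.
suff -> : \sum_(1 <= c < N.+1) (B - 1) * (B ^- c * B ^- c) =
    1 / (B + 1) - B ^- N * B ^- N / (B + 1).
  by rewrite gerBl divr_ge0 ?mulr_ge0 ?invr_ge0 ?exprn_ge0 ?(ltW B0) ?(ltW B1).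
elim: N => [|N IH]; first by rewrite big_geq// expr0 invr1 !mul1r subrr.
rewrite big_nat_recr//= IH exprS; field.
by rewrite expf_neq0 ?gt_eqF.
Qed.

Lemma expVn_le n m : (n <= m)%N -> B ^- m <= B ^- n.
Proof.
move=> nm; rewrite lef_pV2 ?posrE ?exprn_gt0// ler_weXn2l//.
by have := B2; lra.
Qed.

Lemma expVnD n m : B ^- (n + m) = B ^- n * B ^- m.
Proof. by rewrite exprD invfM. Qed.

(* The three summands of [growth] correspond to those of [walsh_step]: adjoining
   [a] to [l] gains a factor [b^-1] at least, and adjoining [a + c] as well gains
   [b^-(c + 1)] at least. *)
Lemma walsh_step_mu_weight r N a l : sorted gtn (a :: l) ->
  S * walsh_step (mu_weight r.+1) N a l <= growth * mu_weight r.+2 (a :: l).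
Proof.
move=> sl; rewrite /walsh_step mulrA (mulrC S) -(mulrA _ _ S) mulVf ?gt_eqF//
  mulr1.
have Bn0 n : 0 <= B ^- n by rewrite invr_ge0 exprn_ge0// (ltW B0).
have B1 : 0 < B + 1 by rewrite addr_gt0.
set X := mu_weight r.+2 (a :: l).
have X0 : 0 <= X by exact: mu_weight_ge0.
rewrite !mulrDr.
(* [B ^- c] occurs twice, from the digit expansion and from the gain in mu, so the geometric series
   sums to at most [1 / (B + 1)]. *)
have sumE (F : nat -> R) y : 0 <= y ->
    (forall c, B ^- a * F c <= X * (y * B ^- c)) ->
    B ^- a * (\sum_(1 <= c < N.+1) (B - 1) * B ^- c * F c) <= X * (y / (B + 1)).
  move=> y0 H; rewrite mulr_sumr.
  apply: (@le_trans _ _ (\sum_(1 <= c < N.+1) X * y * ((B - 1) * (B ^- c * B ^-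
    c)))).
    apply: ler_sum => c _.
    rewrite (_ : B ^- a * _ = (B - 1) * B ^- c * (B ^- a * F c)); last by ring.
    rewrite (_ : X * y * _ = (B - 1) * B ^- c * (X * (y * B ^- c)));
      last by ring.
    by rewrite ler_wpM2l// mulr_ge0//; have := B2; lra.
  rewrite -mulr_sumr mulrA ler_wpM2l ?mulr_ge0//.
  by have := sum_geom2 N; rewrite div1r.
(* For a single digit the first summand is zero, the second is exactly [X] and the third at most
   [X / (B + 1)]; the total is below [growth * X]. *)
have [l0|l0] := eqVneq l [::].
  have XE : X = B ^- a * B ^- (r.+1 * a).
    by rewrite /X l0 /mu_weight /= mu_seq1 mulSn expVnD.
  rewrite l0 /mu_weight /= mulr0 add0r mu_seq1 -XE.
  have /= := sumE (fun c => B ^- mu_seq r.+1 [:: (a + c)%N; a]) 1 ler01.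
  move=> /(_ _)/wrap[c|].
    by rewrite mu_seq_cons /= mu_seq1 XE mulSn !expVnD; apply: eq_le_refl; ring.
  move/(lerD (lexx X))/le_trans; apply.
  rewrite -[X in X + _]mulr1 -mulrDr mulrC ler_wpM2r//.
  rewrite /growth -addrA lerD2l.
  rewrite (_ : 1 / B + _ = (B + 2) / (B * (B + 1))); last first.
    by field; rewrite !gt_eqF.
  rewrite ler_pdivrMr// (_ : (B + 2) / (B * (B + 1)) * (B + 1) = (B + 2) / B);
    last first.
    by field; rewrite !gt_eqF.
  by rewrite ler_pdivlMr//; lra.
have XE : X = B ^- a * B ^- mu_seq r.+1 l.
  by rewrite /X /mu_weight /= mu_seq_cons (negbTE l0) expVnD.
have e1 : B ^- a * mu_weight r.+1 l = X by rewrite /mu_weight (negbTE l0) XE.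
have e2 : B ^- a * mu_weight r.+1 (a :: l) <= X * B^-1.
  rewrite /mu_weight /= XE -mulrA ler_wpM2l// -[B^-1]/(B ^- 1) -expVnD.
  by apply: expVn_le; rewrite addn1; exact: mu_seq_lt.
have /= := sumE (fun c => mu_weight r.+1 ((a + c)%N :: a :: l)) B^-1.
rewrite invr_ge0 (ltW B0) => /(_ isT) /(_ _)/wrap[c|].
  rewrite /mu_weight /= XE -[B^-1]/(B ^- 1) -!expVnD; apply: expVn_le.
  by rewrite mu_seq_cons /=; have := mu_seq_gain r l0 sl; lia.
move/(lerD e2)/(lerD (lexx X)); rewrite e1 addrA => /le_trans; apply.
by apply: eq_le_refl; rewrite /growth; field; rewrite !gt_eqF.
Qed.

(* Bounds for the contributions of the mean of f^(s) and of the L_1 norm of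
   f^(r), respectively, to the Walsh coefficient of f at an index with digit
   positions [l]. *)
Definition mean_bound (s : nat) (l : seq nat) : R :=
  if l == [::] then (s == 0%N)%:R
  else if (s < size l)%N then 0 else mu_weight s l / S ^+ s * growth ^+ (s - 2).

Definition rem_bound (r : nat) (l : seq nat) : R :=
  if r is r'.+1 then 3 / S ^+ r * growth ^+ r' * mu_weight r l
  else (l != [::])%:R.

Lemma growth_ge1 : 1 <= growth.
Proof.
have B1 : 0 < B + 1 by rewrite addr_gt0.
by rewrite /growth -addrA lerDl addr_ge0 ?divr_ge0 ?mulr_ge0 ?(ltW B0) ?(ltW
  B1).
Qed.

Lemma growth_ge0 : 0 <= growth. Proof. exact: le_trans growth_ge1. Qed.

Lemma mean_bound_ge0 s l : 0 <= mean_bound s l.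
Proof.
rewrite /mean_bound; case: ifP => // _; case: ifP => // _.
by rewrite mulr_ge0 ?divr_ge0 ?exprn_ge0 ?mu_weight_ge0 ?growth_ge0 ?(ltW S0).
Qed.

Lemma rem_bound_ge0 s l : 0 <= rem_bound s l.
Proof.
case: s => [|s] //=.
by rewrite !mulr_ge0 ?invr_ge0 ?exprn_ge0 ?mu_weight_ge0 ?growth_ge0 ?(ltW S0).
Qed.

(** At order 0 each of the three summands of [walsh_step] is at most 1, whence the constant 3. Every
    later step costs a factor [growth]. *)
Lemma rem_bound_step r N a l : sorted gtn (a :: l) ->
  walsh_step (rem_bound r) N a l <= rem_bound r.+1 (a :: l).
Proof.
move=> sl; case: r => [|r].
  rewrite /rem_bound expr1 expr0 mulr1 /mu_weight /= mu_seq_cons.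
  rewrite (_ : (if _ then _ else _) = 0%N) ?addn0; last first.
    by case: ifP => _; rewrite ?mul0n// /mu_seq.
  rewrite /walsh_step (_ : 3 / S * _ = B ^- a / S * 3); last by ring.
  rewrite ler_wpM2l//.
    by rewrite divr_ge0 ?invr_ge0 ?exprn_ge0 ?(ltW B0) ?(ltW S0).
  rewrite (_ : 3 = 1 + 1 + 1); last by ring.
  rewrite !lerD//; first by case: (l == [::]).
  by under eq_bigr do rewrite /= mulr1; exact: sum_geom.
rewrite [walsh_step _ _ _ _](walsh_stepZ (mu_weight r.+1) (3 / S ^+ r.+1 *
  growth ^+ r)).
have /(ler_wpM2l (x := 3 / S ^+ r.+2 * growth ^+ r)) :=
  walsh_step_mu_weight r N sl.
rewrite !mulr_ge0 ?invr_ge0 ?exprn_ge0 ?growth_ge0 ?(ltW S0)// => /(_ isT) H.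
rewrite /rem_bound [growth ^+ r.+1]exprSr (le_trans _ (le_trans H _))//.
  apply: eq_le_refl; rewrite [S ^+ r.+2]exprS.
  by field; rewrite expf_neq0 ?gt_eqF.
by rewrite !mulrA.
Qed.

(** If [s] is below the number of positions in [l], all summands vanish. Otherwise, for [s] equal to
    0 or 1, exactly one summand is nonzero, so the first two steps cost no factor [growth]; this
    explains the exponent [s - 2]. *)
Lemma mean_bound_step s N a l : sorted gtn (a :: l) ->
  walsh_step (mean_bound s) N a l <= mean_bound s.+1 (a :: l).
Proof.
move=> sl; rewrite /walsh_step.
have [sl'|ls] := ltnP s (size l).
  have l0 : l != [::] by case: l sl' {sl}.
  rewrite {1 2}/mean_bound (negbTE l0) sl' /= (leq_trans sl')// big1;
    last first.
    by move=> c _; rewrite /mean_bound /= !ltnS (leq_trans (ltnW sl')) ?mulr0//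
      leqnSn.
  by rewrite !addr0 mulr0 mean_bound_ge0.
case: s ls => [|[|s]] ls.
- have l0 : l = [::] by case: l ls {sl}.
  rewrite l0 {1 2}/mean_bound /= big1 ?addr0; last by move=> c _;
    rewrite /mean_bound /= mulr0.
  by rewrite /mean_bound /= /mu_weight /= mu_seq1 mul1n expr1 expr0 !mulr1.
- rewrite big1 ?addr0; last by move=> c _; rewrite /mean_bound /= mulr0.
  case: l ls sl => [|c [|]]//= _ sl.
    rewrite {1 2}/mean_bound /= add0r /mean_bound /= /mu_weight /= !mu_seq1.
    rewrite ?subnn ?sub0n expr0 !mulr1 expr1 mul1n mulSn mul1n expVnD expr2.
    by apply: eq_le_refl; field; rewrite ?expf_neq0 ?gt_eqF.
  rewrite {1 2}/mean_bound /= addr0 /mean_bound /= /mu_weight /= !mu_seq_cons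
    /= ?mul0n ?addn0.
  rewrite ?subnn ?sub0n expr0 !mulr1 expr1 expVnD expr2.
  by apply: eq_le_refl; field; rewrite ?expf_neq0 ?gt_eqF.
have bnd l' : mean_bound s.+2 l' <= growth ^+ s / S ^+ s.+2 * mu_weight s.+2 l'.
  rewrite /mean_bound; case: ifPn => [/eqP ->|_].
    by rewrite /mu_weight /= mulr0.
  case: ifP => _; last by apply: eq_le_refl; rewrite !subSS subn0; ring.
  by rewrite !mulr_ge0 ?invr_ge0 ?exprn_ge0 ?mu_weight_ge0 ?growth_ge0 ?(ltW
    S0).
apply: (le_trans (walsh_step_le N a l bnd)); rewrite walsh_stepZ.
have /(ler_wpM2l (x := growth ^+ s / S ^+ s.+3)) :=
  walsh_step_mu_weight s.+1 N sl.
rewrite !mulr_ge0 ?invr_ge0 ?exprn_ge0 ?growth_ge0 ?(ltW S0)// => /(_ isT) H.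
rewrite /mean_bound /= ltnNge ltnS ls /= (le_trans _ (le_trans H _))//.
  apply: eq_le_refl; rewrite [S ^+ s.+3]exprS.
  by field; rewrite expf_neq0 ?gt_eqF.
rewrite (_ : (s.+3 - 2 = s.+1)%N)// [growth ^+ s.+1]exprS; apply: eq_le_refl;
  ring.
Qed.

End coefficient_bounds.

(** * Walsh functions and their primitives *)

Lemma de_moivre (R : realType) (t : R) n :
  ((cos t +i* sin t) ^+ n)%C = (cos (t * n%:R) +i* sin (t * n%:R))%C.
Proof.
elim: n => [|n IH]; first by rewrite mulr0 cos0 sin0 expr0.
rewrite exprSr IH -(natr1 n) mulrDr mulr1 cosD sinD.
by apply/eqP; rewrite eq_complex /=; apply/andP; split; apply/eqP; ring.
Qed.

(** * Roots of unity and the Fourier expansion of a digit *)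

Section root_of_unity.
Context {R : realType}.
Variable b : nat.
Hypothesis hb : (2 <= b)%N.
Local Notation omega := (omega R b).

Let b0 : 0 < b%:R :> R. Proof. by rewrite ltr0n; lia. Qed.

(* Walsh coefficients involve the conjugates of the Walsh functions. *)
Definition zeta : R[i] := omega^*.

Lemma omegaX n : omega ^+ n =
  (cos (2 * pi / b%:R * n%:R) +i* sin (2 * pi / b%:R * n%:R))%C.
Proof. exact: de_moivre. Qed.

Lemma omega_b : omega ^+ b = 1.
Proof.
by rewrite omegaX divfK ?gt_eqF// (_ : 2 * pi =
  pi *+ 2) ?cos2pi ?sin2pi// mulr_natl.
Qed.

Lemma zeta_b : zeta ^+ b = 1.
Proof. by rewrite /zeta -rmorphXn omega_b rmorph1. Qed.

Lemma zetaXJ n : zeta ^+ n = (omega ^+ n)^*.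
Proof. by rewrite /zeta rmorphXn. Qed.

Lemma norm_omega : `|omega| = 1.
Proof. by rewrite normc_def /= cos2Dsin2 sqrtr1. Qed.

Lemma norm_zetaX n : `|zeta ^+ n| = 1.
Proof. by rewrite zetaXJ norm_conjC normrX norm_omega expr1n. Qed.

(* The distance from [1] to [omega]. *)
Definition chord : R := 2 * sin (pi / b%:R).

Lemma chord_gt0 : 0 < chord.
Proof.
rewrite mulr_gt0// sin_gt0_pi// divr_gt0 ?pi_gt0//=.
by rewrite ltr_pdivrMr// ltr_pMr ?pi_gt0// ltr1n.
Qed.

(** Among the nontrivial powers the first is nearest to 1: by symmetry [n] can be replaced by
    [b - n] to get an angle in [[0, pi]], where cosine decreases. *)
Lemma chord_le n : (0 < n < b)%N -> chord%:C%C <= `|1 - zeta ^+ n|.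
Proof.
move=> /andP[n0 nb].
have -> : 1 - zeta ^+ n = (1 - omega ^+ n)^* by rewrite rmorphB rmorph1 zetaXJ.
rewrite norm_conjC omegaX normc_def lecR /=.
set x := 2 * pi / b%:R * n%:R.
have -> : (1 - cos x) ^+ 2 + (0 - sin x) ^+ 2 = 2 * (1 - cos x).
  by have := cos2Dsin2 x; nra.
rewrite -[chord]gtr0_norm ?chord_gt0// -sqrtr_sqr ler_sqrt; last first.
  by rewrite mulr_ge0// subr_ge0 cos_le1.
have -> : chord ^+ 2 = 2 * (1 - cos (2 * pi / b%:R)).
  rewrite (_ : 2 * pi / b%:R = (pi / b%:R) *+ 2) ?cos_mulr2n.
    by rewrite /chord exprMn sin2cos2 mulr2n; ring.
  by rewrite -[RHS]mulr_natl mulrA.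
rewrite ler_pM2l// lerD2l lerN2.
have pi0 : 0 < pi :> R := pi_gt0 R.
have cos_le (u v : R) : 0 <= u -> u <= v -> v <= pi -> cos v <= cos u.
  move=> u0 uv v1; rewrite leNgt ltr_cos -?leNgt// in_itv/= ?u0 ?(le_trans
    uv)//.
  by rewrite v1 (le_trans u0).
pose P : R := pi; have P0 : 0 < P := pi0.
have le_cos m : (0 < m)%N -> (m * 2 <= b)%N ->
    cos (2 * P / b%:R * m%:R) <= cos (2 * P / b%:R).
  move=> m0 mb; have m1 : 1 <= m%:R :> R by rewrite ler1n.
  have mb' : m%:R * 2 <= b%:R :> R by rewrite -natrM ler_nat.
  have p0 : 0 <= 2 * P / b%:R by rewrite divr_ge0// ?mulr_ge0// ltW.
  apply: cos_le => //; first exact: ler_peMr.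
  rewrite -/P -(ler_pM2r b0) mulrAC divfK ?gt_eqF//.
  by rewrite -mulrA mulrCA ler_pM2l// mulrC.
rewrite -/P /x -/P.
have [mb|mb] := leqP (n * 2) b; first exact: le_cos.
have -> : cos (2 * P / b%:R * n%:R) = cos (2 * P / b%:R * (b - n)%:R).
  rewrite natrB ?(ltnW nb)// mulrBr divfK ?gt_eqF//.
  rewrite -[RHS]cosN opprB -[RHS](cosD2pi _) -/P; congr cos.
  by rewrite -[P *+ 2]mulr_natl; ring.
by apply: le_cos; lia.
Qed.

Lemma zetaX_neq1 n : (0 < n < b)%N -> 1 - zeta ^+ n != 0.
Proof.
by move=> /chord_le h; rewrite -normr_gt0 (lt_le_trans _ h)// ltcR chord_gt0.
Qed.

Lemma norm_inv_chord n : (0 < n < b)%N ->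
  `|(1 - zeta ^+ n)^-1| <= (chord^-1)%:C%C.
Proof.
move=> nb; rewrite normfV fmorphV lef_pV2 ?chord_le//.
  by rewrite posrE normr_gt0 zetaX_neq1.
by rewrite posrE ltcR chord_gt0.
Qed.

Lemma norm_half_chord n : (0 < n < b)%N ->
  `|1 / 2 - (1 - zeta ^+ n)^-1| <= (chord^-1)%:C%C.
Proof.
move=> nb; have n1 := zetaX_neq1 nb.
have -> : 1 / 2 - (1 - zeta ^+ n)^-1 =
  - ((1 + zeta ^+ n) / 2) * (1 - zeta ^+ n)^-1.
  by field.
rewrite normrM normrN -[leRHS]mul1r; apply: ler_pM => //;
  last exact: norm_inv_chord.
rewrite normrM normfV [`|2|]ger0_norm// ler_pdivrMr// mul1r.
by rewrite (le_trans (ler_normD _ _))// normr1 norm_zetaX.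
Qed.

(* Discrete Fourier coefficients of the identity on the digits. *)
Definition digit_coef n : R[i] := zeta ^+ n / (1 - zeta ^+ n).

Lemma norm_digit_coef n : (0 < n < b)%N -> `|digit_coef n| <= (chord^-1)%:C%C.
Proof. by move=> nb; rewrite normrM norm_zetaX mul1r norm_inv_chord. Qed.

Lemma sum_zeta m : (0 < m < b)%N -> \sum_(0 <= i < b) zeta ^+ (i * m) = 0.
Proof.
move=> mb; have := zetaX_neq1 mb; rewrite subr_eq0 eq_sym => m1.
have : (zeta ^+ m) ^+ b - 1 =
  0 by rewrite -exprM mulnC exprM zeta_b expr1n subrr.
rewrite subrX1 => /eqP; rewrite mulf_eq0 subr_eq0 (negbTE m1) /= => /eqP s0.
rewrite -[RHS]s0 big_mkord; by apply: eq_bigr => i _; rewrite mulnC exprM.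
Qed.

(** Passing from [d] to [d.+1] changes the Fourier sum by minus the sum of the nontrivial powers of
    [zeta ^+ d.+1], that is by 1. At [d = 0], pairing [i] with [b - i] evaluates the sum. *)
Lemma digit_expansion d : (d < b)%N ->
  d%:R = (b%:R - 1) / 2 + \sum_(1 <= i < b) digit_coef i * zeta ^+ (i * d).
Proof.
elim: d => [_|d IH db].
  have zb i : (0 < i < b)%N -> zeta ^+ (b - i) = (zeta ^+ i)^-1.
    move=> ib; have z0 : zeta ^+ i != 0 by rewrite -normr_eq0 norm_zetaX
      oner_eq0.
    apply: (mulIf z0); rewrite mulVf// -exprD subnK ?zeta_b//; lia.
  have pairE i : (0 < i < b)%N -> digit_coef i + digit_coef (b - i) = -1.
    move=> ib; rewrite /digit_coef zb//; have := zetaX_neq1 ib.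
    have z0 : zeta ^+ i != 0 by rewrite -normr_eq0 norm_zetaX oner_eq0.
    move=> n1; field; rewrite n1 z0 /=.
    by rewrite -opprB oppr_eq0 n1.
  under eq_bigr do rewrite muln0 expr0 mulr1.
  have : \sum_(1 <= i < b) digit_coef i + \sum_(1 <= i < b) digit_coef i =
    - (b%:R - 1).
    rewrite {2}big_nat_rev /= -big_split /= (eq_big_nat _ _ (F2 := fun=> -1)).
      by rewrite sumr_const_nat mulNrn natrB//; lia.
    move=> i ib; rewrite (_ : (1 + b - i.+1 = b - i)%N) ?pairE//; lia.
  set s := \sum_(1 <= i < b) _ => ss; rewrite mulr0n (_ : s = (s + s) / 2);
    last by field.
  by rewrite ss; field.
rewrite -natr1 IH ?(ltnW db)// -addrA; congr (_ + _).
apply/eqP; rewrite eq_sym -subr_eq0 opprD addrA -sumrB subr_eq0; apply/eqP.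
have := sum_zeta (m := d.+1); rewrite db big_ltn ?mul0n ?expr0; last by lia.
move=> /(_ isT)/eqP; rewrite addr_eq0 => /eqP ->; rewrite -sumrN.
apply: eq_big_nat => i ib; have n1 := zetaX_neq1 ib.
rewrite /digit_coef mulnS exprD; field.
exact: n1.
Qed.

End root_of_unity.

(** * Pointwise formulas for Walsh functions and their primitives *)

Section walsh_pointwise.
Context {R : realType}.
Variable b : nat.
Hypothesis hb : (2 <= b)%N.
Local Notation zeta := (@zeta R b).
Local Notation B := (b%:R : R).

Let B0 : 0 < B. Proof. by rewrite ltr0n; lia. Qed.

Definition walc (k : nat) (x : R) : R[i] := (wal b k x)^*.

Lemma walcE k x : walc k x =
  zeta ^+ (\sum_(a <- digit_pos b k) nat_digit b k a * real_digit b x a)%N.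
Proof. by rewrite /walc /wal rmorphXn. Qed.

Definition trunc_b (n : nat) (x : R) : nat := Num.truncn (x * B ^+ n).

Lemma trunc_b_itv n (x : R) : 0 <= x ->
  (trunc_b n x)%:R <= x * B ^+ n < (trunc_b n x).+1%:R.
Proof. by move=> x0; apply: truncn_itv; rewrite mulr_ge0// exprn_ge0// ltW. Qed.

Lemma trunc_b_divn n m (x : R) : 0 <= x ->
  (trunc_b (n + m) x %/ b ^ m = trunc_b n x)%N.
Proof.
move=> x0; have /andP[l1 l2] := trunc_b_itv (n + m) x0.
have Bm : 0 < B ^+ m by rewrite exprn_gt0.
have bm : (0 < b ^ m)%N by rewrite expn_gt0; lia.
apply/esym/eqP; rewrite /trunc_b truncn_eq ?mulr_ge0 ?exprn_ge0 ?(ltW B0)//.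
rewrite exprD mulrA in l1 l2; apply/andP; split.
  rewrite -(ler_pM2r Bm); apply: le_trans l1.
  by rewrite -[B ^+ m]natrX -natrM ler_nat leq_divM.
rewrite -(ltr_pM2r Bm); apply: (lt_le_trans l2).
by rewrite -[B ^+ m]natrX -natrM ler_nat -ltn_divLR.
Qed.

Lemma trunc_bS n (x : R) : 0 <= x ->
  trunc_b n.+1 x = (trunc_b n x * b + real_digit b x n.+1)%N.
Proof.
by move=> x0; rewrite -(trunc_b_divn n 1 x0) addn1 expn1 -divn_eq.
Qed.

Lemma real_digit_trunc_b n i (x : R) : 0 <= x -> (i <= n)%N ->
  real_digit b x i = ((trunc_b n x %/ b ^ (n - i)) %% b)%N.
Proof. by move=> x0 iN; rewrite -{1}(subnKC iN) trunc_b_divn. Qed.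

Lemma walc_cons n m k (x : R) : (0 < n)%N -> (k < b ^ n.-1)%N ->
  (0 < m < b)%N ->
  walc (m * b ^ n.-1 + k) x = zeta ^+ (m * real_digit b x n) * walc k x.
Proof.
move=> n0 kn mb; rewrite !walcE digit_pos_cons// big_cons exprD.
have mb' : (m < b)%N by case/andP: mb.
rewrite nat_digit_addmul// ltnn eqxx; congr (_ * _ ^+ _).
apply: eq_big_seq => c; rewrite mem_digit_pos// => /andP[c0 dc].
rewrite nat_digit_addmul//; case: ifPn => //; rewrite -leqNgt => nc.
move: dc; rewrite /nat_digit divn_small ?mod0n//.
by apply: (leq_trans kn); apply: leq_pexp2l; lia.
Qed.

(* Value of [walc k] at any point of the [j]th elementary interval of length
   [b^-n]. *)
Definition walc_step (k n j : nat) : R[i] :=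
  zeta ^+ (\sum_(a <- digit_pos b k) nat_digit b k a * ((j %/ b ^ (n - a)) %%
    b))%N.

Lemma walc_stepE k n (x : R) : 0 <= x -> (k < b ^ n)%N ->
  walc k x = walc_step k n (trunc_b n x).
Proof.
move=> x0 kn; rewrite walcE /walc_step; congr (_ ^+ _).
apply: eq_big_seq => c; rewrite mem_digit_pos// => /andP[c0 dc].
rewrite (@real_digit_trunc_b n)// leqNgt; apply/negP => nc.
move: dc; rewrite /nat_digit divn_small ?mod0n//.
by apply: (leq_trans kn); apply: leq_pexp2l; lia.
Qed.

Lemma walc_step_cons n m k j : (0 < n)%N -> (k < b ^ n.-1)%N -> (0 < m < b)%N ->
  walc_step (m * b ^ n.-1 + k) n j =
  walc_step k n.-1 (j %/ b) * (zeta ^+ m) ^+ (j %% b).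
Proof.
move=> n0 kn mb; rewrite /walc_step digit_pos_cons// big_cons addnC exprD.
have mb' : (m < b)%N by case/andP: mb.
rewrite nat_digit_addmul// ltnn eqxx subnn expn0 divn1 -exprM;
  congr (_ ^+ _ * _).
apply: eq_big_seq => c; rewrite mem_digit_pos// => /andP[c0 dc].
rewrite nat_digit_addmul//; case: ltnP => nc.
  rewrite -divnMA -expnS; congr (_ * (_ %/ _ ^ _ %% _))%N; lia.
move: dc; rewrite /nat_digit divn_small ?mod0n//.
by apply: (leq_trans kn); apply: leq_pexp2l; lia.
Qed.

(** A full block of [b] consecutive intervals contributes a vanishing sum of roots of unity; only
    the unfinished block remains. *)
Lemma sum_walc_step n m k T : (0 < n)%N -> (k < b ^ n.-1)%N -> (0 < m < b)%N ->
  \sum_(0 <= j < T) walc_step (m * b ^ n.-1 + k) n j =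
  walc_step k n.-1 (T %/ b) * \sum_(i < T %% b) (zeta ^+ m) ^+ i.
Proof.
move=> n0 kn mb.
have b0 : (0 < b)%N by lia.
under eq_bigr do rewrite walc_step_cons//.
have block q d : (d <= b)%N -> \sum_(q * b <= j < q * b + d)
    walc_step k n.-1 (j %/ b) * (zeta ^+ m) ^+ (j %% b) =
    walc_step k n.-1 q * \sum_(i < d) (zeta ^+ m) ^+ i.
  move=> db; rewrite -{1}[(q * b)%N]add0n big_addn addKn big_mkord mulr_sumr.
  apply: eq_bigr => i _; rewrite addnC divnMDl// modnMDl.
  have ib : (i < b)%N by exact: leq_trans db.
  by rewrite divn_small// addn0 modn_small.
have z0 : \sum_(i < b) (zeta ^+ m) ^+ i = 0.
  have := sum_zeta hb (R := R) mb; rewrite big_mkord => z0.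
  by rewrite -[RHS]z0; apply: eq_bigr => i _; rewrite mulnC exprM.
have full q : \sum_(0 <= j < q * b)
    walc_step k n.-1 (j %/ b) * (zeta ^+ m) ^+ (j %% b) = 0.
  elim: q => [|q IH]; first by rewrite mul0n big_geq.
  rewrite mulSnr (big_cat_nat (n := (q * b)%N))//= ?leq_addr// IH add0r.
  by rewrite block// z0 mulr0.
rewrite {1}(divn_eq T b) (big_cat_nat (n := (T %/ b * b)%N))//= ?leq_addr//.
by rewrite full add0r block// ltnW// ltn_mod.
Qed.

(* The primitive of [walc k] vanishing at [0], multiplied by [b^n]. *)
Definition walc_prim (k n : nat) (x : R) : R[i] :=
  \sum_(0 <= j < trunc_b n x) walc_step k n j +
  walc_step k n (trunc_b n x) * (x * B ^+ n - (trunc_b n x)%:R)%:C%C.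

(** The unfinished block is the geometric sum [(1 - z ^+ d) / (1 - z)], whose two parts give a term
    at [k] and a term at the full index. *)
Lemma walc_primE n m k (x : R) : (0 < n)%N -> (k < b ^ n.-1)%N ->
  (0 < m < b)%N ->
  0 <= x -> walc_prim (m * b ^ n.-1 + k) n x =
  (1 - zeta ^+ m)^-1 * walc k x +
  ((x * B ^+ n - (trunc_b n x)%:R)%:C%C - (1 - zeta ^+ m)^-1) *
     walc (m * b ^ n.-1 + k) x.
Proof.
move=> n0 kn mb x0; rewrite /walc_prim sum_walc_step// walc_step_cons//.
have -> : (trunc_b n x %/ b)%N = trunc_b n.-1 x.
  by rewrite -{1}(prednK n0) -addn1 -[X in (_ %/ X)%N]expn1 trunc_b_divn.
rewrite -walc_stepE// walc_cons// exprM.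
have -> : (trunc_b n x %% b)%N = real_digit b x n by [].
set z := zeta ^+ m; set d := real_digit b x n; set y := (_ - _)%:C%C.
have z1 : 1 - z != 0 by exact: zetaX_neq1.
have -> : \sum_(i < d) z ^+ i = (1 - z ^+ d) / (1 - z).
  apply: (mulIf z1); rewrite divfK// -[RHS]opprB subrX1 -mulNr opprB.
  exact: mulrC.
by field.
Qed.

(** A finite expansion with controlled remainder replaces the series: [e] is the fractional part at
    level [n + N], scaled back. *)
Lemma frac_digits n N (x : R) : 0 <= x ->
  exists2 e : R, 0 <= e <= B ^- N &
  x * B ^+ n - (trunc_b n x)%:R =
  \sum_(1 <= c < N.+1) B ^- c * (real_digit b x (n + c))%:R + e.
Proof.
move=> x0; exists ((x * B ^+ (n + N) - (trunc_b (n + N) x)%:R) * B ^- N).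
  have BN : 0 <= B ^- N by rewrite invr_ge0 exprn_ge0// ltW.
  have /andP[l1 l2] := trunc_b_itv (n + N) x0.
  rewrite mulr_ge0 ?subr_ge0//= ler_piMl// lerBlDl natr1; exact: ltW.
elim: N => [|N IH]; first by rewrite addn0 big_geq// expr0 invr1 mulr1 add0r.
rewrite big_nat_recr//= addnS trunc_bS// IH -addrA; congr (_ + _).
rewrite natrD natrM !exprS; field.
by rewrite expf_neq0 ?gt_eqF.
Qed.

(** Each digit in [walc_primE] is replaced by its Fourier expansion: the constant terms tend to the
    mean [1 / 2], and every other term multiplies the Walsh function into one with an additional
    leading digit. *)
Lemma walc_prim_expansion n m k N (x : R) :
  (0 < n)%N -> (k < b ^ n.-1)%N -> (0 < m < b)%N -> 0 <= x ->
  exists2 rho : R, `|rho| <= B ^- N &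
  walc_prim (m * b ^ n.-1 + k) n x =
  (1 - zeta ^+ m)^-1 * walc k x +
  (1 / 2 - (1 - zeta ^+ m)^-1) * walc (m * b ^ n.-1 + k) x +
  \sum_(1 <= c < N.+1) \sum_(1 <= i < b) ((B ^- c)%:C%C * digit_coef b i) *
     walc (i * b ^ (n + c).-1 + (m * b ^ n.-1 + k)) x
  + rho%:C%C * walc (m * b ^ n.-1 + k) x.
Proof.
move=> n0 kn mb x0; have [e /andP[e0 eN] xE] := frac_digits n N x0.
have BN : 0 <= B ^- N by rewrite invr_ge0 exprn_ge0// ltW.
(* The constant terms of [N] digits add up to [(1 - B ^- N) / 2]; [rho] collects the defect from
   [1 / 2] and the remainder [e]. *)
exists (e - B ^- N / 2).
  by rewrite ler_norml; apply/andP; split; lra.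
rewrite walc_primE// -!addrA; congr (_ + _).
set K := (m * b ^ n.-1 + k)%N; set z := (1 - _)^-1.
have Kn : (K < b ^ n)%N.
  rewrite /K -[in X in (_ < X)%N](prednK n0) expnS.
  apply: (@leq_trans (m.+1 * b ^ n.-1)); first by rewrite mulSn; lia.
  by rewrite leq_mul2r; case/andP: mb => _ ->; rewrite orbT.
have inner c : (0 < c)%N -> \sum_(1 <= i < b) (B ^- c)%:C%C * digit_coef b i *
    walc (i * b ^ (n + c).-1 + K) x =
    (B ^- c)%:C%C * ((real_digit b x (n + c))%:R - (b%:R - 1) / 2) * walc K x.
  move=> c0; rewrite (eq_big_nat _ _ (F2 := fun i => (B ^- c)%:C%C *
    (digit_coef b i * zeta ^+ (i * real_digit b x (n + c))) * walc K x));
      last first.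
    move=> i ib; rewrite walc_cons//; first by ring.
    - by rewrite ltn_addr.
    - by apply: (leq_trans Kn); apply: leq_pexp2l; lia.
  rewrite -mulr_suml -mulr_sumr; congr (_ * _ * _).
  have db : (real_digit b x (n + c) < b)%N by rewrite ltn_mod; lia.
  by rewrite (digit_expansion (R := R) hb db) addrAC subrr add0r.
rewrite (eq_big_nat _ _ (F2 := fun c => (B ^- c)%:C%C *
  ((real_digit b x (n + c))%:R - (b%:R - 1) / 2) * walc K x)); last first.
  by move=> c /andP[c0 _]; exact: inner.
rewrite -mulr_suml -!mulrDl; congr (_ * _).
have -> : \sum_(1 <= c < N.+1) (B ^- c)%:C%C *
    ((real_digit b x (n + c))%:R - (b%:R - 1) / 2) =
    (\sum_(1 <= c < N.+1) B ^- c * (real_digit b x (n + c))%:R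
     - (1 - B ^- N) / 2)%:C%C :> R[i].
  have gE : \sum_(1 <= c < N.+1) B ^- c * ((B - 1) / 2) = (1 - B ^- N) / 2.
    elim: N {e eN xE BN e0} => [|N IH];
      first by rewrite big_geq// expr0 invr1 subrr mul0r.
    by rewrite big_nat_recr//= IH exprS; field; rewrite expf_neq0 ?gt_eqF.
  rewrite -gE -sumrB rmorph_sum; apply: eq_bigr => c _.
  rewrite -mulrBr rmorphM; congr (_ * _).
  by rewrite !rmorphB !rmorphM fmorphV rmorphB !rmorph_nat rmorph1.
rewrite xE; set s := \sum_(1 <= c < N.+1) _.
rewrite -rmorphD (_ : s - (1 - B ^- N) / 2 + (e - B ^- N / 2) =
  (s + e) - 1 / 2); last by lra.
rewrite [in RHS]rmorphB [X in _ =
  _ + (_ - X)]rmorphM fmorphV rmorph1 rmorph_nat.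
by rewrite [in RHS]addrC addrA subrK.
Qed.

End walsh_pointwise.

(** * Measurability and integrals of step functions *)

Section step_functions.
Context {R : realType}.
Local Notation mu := lebesgue_measure.
Implicit Types (G : nat -> R) (c t : R).

Lemma measurable_step G c : 0 < c ->
  measurable_fun setT (fun x : R => G (Num.truncn (x * c))).
Proof.
move=> c0 _ Y mY; rewrite setTI.
have mle m : measurable [set x : R | (Num.truncn (x * c)%R <= m)%N].
  rewrite (_ : [set _ | _] = `]-oo, m.+1%:R / c[%classic) //.
  by apply/seteqP; split => x /=; rewrite truncn_le_nat in_itv/= ltr_pdivlMr.
rewrite (_ : _ @^-1` _ = \bigcup_(m in [set m | Y (G m)])
  [set x : R | Num.truncn (x * c)%R = m]).
  apply: bigcup_measurable => -[|m] _.
    rewrite (_ : [set _ | _] = [set x : R | (Num.truncn (x * c)%R <= 0)%N])//.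
    by apply/seteqP; split => x /= ; [move=> ->|rewrite leqn0 => /eqP].
  rewrite (_ : [set _ | _] = [set x : R | (Num.truncn (x * c)%R <= m.+1)%N] `\`
    [set x : R | (Num.truncn (x * c)%R <= m)%N]); first exact: measurableD.
  apply/seteqP; split => x /=; first by move=> ->; rewrite ltnn.
  by case=> h1 /negP h2; lia.
apply/seteqP; split => x /=; first by move=> h; exists (Num.truncn (x * c)).
by case=> m /= h ->.
Qed.

Lemma integrable_bounded (D : set R) (g : R -> R) M : measurable D ->
  (mu D < +oo)%E -> measurable_fun setT g -> (forall x, `|g x| <= M) ->
  mu.-integrable D (EFin \o g).
Proof.
move=> mD muD mg gM; apply: measurable_bounded_integrable => //.
  exact: measurable_funTS.
exists M; split; first exact: num_real.
by move=> x Mx y _; exact: le_trans (gM y) (ltW Mx).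
Qed.

Lemma integrable01_cst1 : mu.-integrable `[0, 1] (EFin \o (fun=> 1 : R)).
Proof.
apply: (integrable_bounded (M := 1)) => //; last by move=> x; rewrite normr1.
by rewrite lebesgue_measure_itv/=; case: ifP => _; rewrite ?ltry// -EFinB ltry.
Qed.

Lemma Rintegral_step G c t M : 0 < c -> 0 <= t -> (forall j, `|G j| <= M) ->
  Rintegral mu `[0, t] (fun x => G (Num.truncn (x * c))) =
  (\sum_(0 <= j < Num.truncn (t * c)) G j +
   G (Num.truncn (t * c)) * (t * c - (Num.truncn (t * c))%:R)) / c.
Proof.
move=> c0 t0 GM; pose g (x : R) := G (Num.truncn (x * c)); rewrite -/g.
have mg : measurable_fun setT g by exact: measurable_step.
have ig (x y : R) : mu.-integrable `[x, y] (EFin \o g).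
  apply: (integrable_bounded (M := M)) => //; last by move=> z; exact: GM.
  by rewrite lebesgue_measure_itv/=; case: ifP => _;
    rewrite ?ltry// -EFinB ltry.
have igo (u v : R) : mu.-integrable `[u, v[%classic (EFin \o g).
  by apply: integrableS (ig u v) => //; apply: subset_itvl; rewrite bnd_simp.
have piece m s : m%:R <= s * c -> s * c <= m.+1%:R ->
    Rintegral mu `[m%:R / c, s[ g = G m * (s * c - m%:R) / c.
  move=> ms sm; transitivity (Rintegral mu `[m%:R / c, s[ (fun=> G m)).
    apply: eq_Rintegral => x;
      rewrite inE /= in_itv/= ler_pdivrMr// => /andP[mx xs].
    rewrite /g (@truncn_def _ _ m)// mx (lt_le_trans _ sm)// ltr_pM2r//.
  rewrite Rintegral_cst//; have /= := lebesgue_measure_itv `[m%:R / c, s[;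
    rewrite lte_fin => ->.
  have ms' : m%:R / c <= s by rewrite ler_pdivrMr.
  case: ltrP => h /=; first by field; rewrite gt_eqF.
  have -> : s = m%:R / c by apply/eqP; rewrite eq_le h.
  by rewrite divfK ?gt_eqF// subrr !(mulr0, mul0r).
have split_at (x y : R) : 0 <= x -> x <= y ->
    Rintegral mu `[0, y[ g = Rintegral mu `[0, x[ g + Rintegral mu `[x, y[ g.
  move=> x0 xy; rewrite -Rintegral_setU//.
  - by rewrite -itv_bndbnd_setU// bnd_simp.
  - by rewrite -itv_bndbnd_setU// bnd_simp.
  - apply/disj_setPS => z [] /=; rewrite !in_itv/= => /andP[_ zx] /andP[xz _].
    by have := lt_le_trans zx xz; rewrite ltxx.
have nodes m : Rintegral mu `[0, m%:R / c[ g = (\sum_(0 <= j < m) G j) / c.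
  elim: m => [|m IH].
    by rewrite mul0r big_geq// mul0r set_itvco0 Rintegral_set0.
  rewrite (split_at (m%:R / c)) ?divr_ge0 ?(ltW c0)//; last first.
    by rewrite ler_pM2r ?invr_gt0// ler_nat.
  rewrite IH piece ?divfK ?gt_eqF ?ler_nat// big_nat_recr//= mulrDl.
  by rewrite -natr1 (addrC m%:R) addrK mulr1.
rewrite -Rintegral_itv_bndo_bndc//.
have /andP[T1 T2] := truncn_itv (mulr_ge0 t0 (ltW c0)).
rewrite (split_at ((Num.truncn (t * c))%:R / c)) ?divr_ge0 ?(ltW c0)//;
  last first.
  by rewrite ler_pdivrMr.
by rewrite nodes piece// ?ltW// mulrDl.
Qed.

End step_functions.

(** * Integration against Walsh functions *)

Section pairing.
Context {R : realType}.
Local Notation mu := lebesgue_measure.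
Local Notation I01 := `[0%R, 1%R]%classic.
Local Notation Re := (@complex.Re R).
Local Notation Im := (@complex.Im R).
Implicit Types (g u v : R -> R) (w : R -> R[i]).

(** The multipliers under which integrability on [[0, 1]] is preserved. *)
Definition bounded_meas u :=
  measurable_fun setT u /\ exists M, forall x, I01 x -> `|u x| <= M.

Lemma bounded_meas_lin a c u v : bounded_meas u -> bounded_meas v ->
  bounded_meas (fun x => a * u x + c * v x).
Proof.
move=> [mu1 [M uM]] [mv [N vN]]; split.
  by apply: measurable_funD; apply: measurable_funM => //;
    exact: measurable_cst.
exists (`|a| * M + `|c| * N) => x xI;
  rewrite (le_trans (ler_normD _ _))// lerD//.
  by rewrite normrM ler_wpM2l// uM.
by rewrite normrM ler_wpM2l// vN.
Qed.

Lemma bounded_meas_integrable g u : mu.-integrable I01 (EFin \o g) ->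
  bounded_meas u -> mu.-integrable I01 (EFin \o (fun x => g x * u x)).
Proof.
move=> ig [mu1 [M uM]].
suff H : mu.-integrable I01 ((EFin \o g) \* (EFin \o u))%E by exact: H.
apply: integrableMl => //; first exact: measurable_funTS.
exists M; split; first exact: num_real.
by move=> x Mx y yI; exact: le_trans (uM y yI) (ltW Mx).
Qed.

Lemma Rintegral_mul_lin g a c u v : mu.-integrable I01 (EFin \o g) ->
  bounded_meas u -> bounded_meas v ->
  Rintegral mu I01 (fun x => g x * (a * u x + c * v x)) =
  a * Rintegral mu I01 (fun x => g x * u x) + c * Rintegral mu I01 (fun x =>
    g x * v x).
Proof.
move=> ig bu bv.
have iu := bounded_meas_integrable ig bu;
  have iv := bounded_meas_integrable ig bv.
rewrite -!RintegralZl// -RintegralD//.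
- by apply: eq_Rintegral => x _; ring.
- exact: (integrableZl _ _ iu).
- exact: (integrableZl _ _ iv).
Qed.

Lemma bounded_measM u v : bounded_meas u -> bounded_meas v ->
  bounded_meas (fun x => u x * v x).
Proof.
move=> [mu1 [M uM]] [mv [N vN]]; split; first exact: measurable_funM.
by exists (M * N) => x xI; rewrite normrM ler_pM ?uM ?vN.
Qed.

Definition cbounded_meas w := bounded_meas (Re \o w) /\ bounded_meas (Im \o w).

Lemma cbounded_meas_ext w w' : w =1 w' -> cbounded_meas w -> cbounded_meas w'.
Proof. by move=> /funext ->. Qed.

Lemma cbounded_measD w w' : cbounded_meas w -> cbounded_meas w' ->
  cbounded_meas (fun x => w x + w' x).
Proof.
move=> [r i] [r' i']; split.
  have := bounded_meas_lin 1 1 r r'; congr bounded_meas; apply/funext => x /=.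
  by rewrite !mul1r; case: (w x); case: (w' x).
have := bounded_meas_lin 1 1 i i'; congr bounded_meas; apply/funext => x /=.
by rewrite !mul1r; case: (w x); case: (w' x).
Qed.

Lemma cbounded_measZ c w : cbounded_meas w -> cbounded_meas (fun x => c * w x).
Proof.
move=> [r i]; split.
  have := bounded_meas_lin (Re c) (- Im c) r i; congr bounded_meas.
  by apply/funext => x /=; case: c => a d; case: (w x) => p q /=; rewrite mulNr.
have := bounded_meas_lin (Re c) (Im c) i r; congr bounded_meas.
by apply/funext => x /=; case: c => a d; case: (w x) => p q /=.
Qed.

Lemma cbounded_measM u w : bounded_meas u -> cbounded_meas w ->
  cbounded_meas (fun x => (u x)%:C%C * w x).
Proof.
move=> bu [r i]; split.
  have := bounded_measM bu r; congr bounded_meas.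
  by apply/funext => x /=; case: (w x) => p q /=; rewrite mul0r subr0.
have := bounded_measM bu i; congr bounded_meas.
by apply/funext => x /=; case: (w x) => p q /=; rewrite mul0r addr0.
Qed.

Lemma cbounded_meas0 : cbounded_meas (fun=> 0).
Proof.
by split; split; [exact: measurable_cst|exists 0 => x _ /=;
  rewrite normr0|exact: measurable_cst|exists 0 => x _ /=; rewrite normr0].
Qed.

Lemma cbounded_meas_sum m n (F : nat -> R -> R[i]) :
  (forall i, (m <= i < n)%N -> cbounded_meas (F i)) ->
  cbounded_meas (fun x => \sum_(m <= i < n) F i x).
Proof.
elim: n => [|n IH] bF.
  apply: cbounded_meas_ext cbounded_meas0 => x; by rewrite big_geq.
have [mn|nm] := leqP m n; last first.
  by apply: cbounded_meas_ext cbounded_meas0 => x; rewrite big_geq.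
apply: (cbounded_meas_ext (w := fun x => \sum_(m <= i < n) F i x + F n x)).
  by move=> x; rewrite big_nat_recr.
apply: cbounded_measD; last by apply: bF; rewrite mn /=.
by apply: IH => i /andP[mi ni]; apply: bF; rewrite mi ltnW.
Qed.

(** At a conjugate Walsh function this is [walsh_coef]; the second argument is free so that
    primitives and their expansions can be paired too. *)
Definition cpair g w : R[i] := complex_integral I01 (fun x => (g x)%:C%C * w x).

Lemma cpairE g w : cpair g w =
  (Rintegral mu I01 (fun x => g x * Re (w x)) +i*
   Rintegral mu I01 (fun x => g x * Im (w x)))%C.
Proof.
rewrite /cpair /complex_integral; congr (_ +i* _)%C; apply: eq_Rintegral => x _;
  by case: (w x) => p q /=; rewrite mul0r ?subr0 ?addr0.
Qed.

Lemma eq_cpair g w w' : {in I01, w =1 w'} -> cpair g w = cpair g w'.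
Proof.
by move=> ww'; rewrite !cpairE; congr (_ +i* _)%C; apply: eq_Rintegral => x xI;
  rewrite ww'.
Qed.

Variable g : R -> R.
Hypothesis ig : mu.-integrable I01 (EFin \o g).

Lemma cpairZ c w : cbounded_meas w ->
  cpair g (fun x => c * w x) = c * cpair g w.
Proof.
move=> [r i]; rewrite !cpairE; case: c => a d; apply/eqP; rewrite eq_complex /=.
apply/andP; split; apply/eqP.
  rewrite -mulNr -Rintegral_mul_lin//; apply: eq_Rintegral => x _ /=.
  by case: (w x) => p q /=; rewrite mulNr.
rewrite -Rintegral_mul_lin//; apply: eq_Rintegral => x _ /=.
by case: (w x) => p q /=.
Qed.

Lemma cpairD w w' : cbounded_meas w -> cbounded_meas w' ->
  cpair g (fun x => w x + w' x) = cpair g w + cpair g w'.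
Proof.
move=> [r i] [r' i']; rewrite !cpairE; apply/eqP; rewrite eq_complex /=.
apply/andP; split; apply/eqP.
  rewrite -[LHS]/(Rintegral _ _ _) -[X in _ = X + _]mul1r -[X in _ =
    _ + X]mul1r.
  rewrite -Rintegral_mul_lin//; apply: eq_Rintegral => x _ /=; rewrite !mul1r.
  by case: (w x); case: (w' x).
rewrite -[X in _ = X + _]mul1r -[X in _ = _ + X]mul1r.
rewrite -Rintegral_mul_lin//; apply: eq_Rintegral => x _ /=; rewrite !mul1r.
by case: (w x); case: (w' x).
Qed.

Lemma cpair_sum m n (F : nat -> R -> R[i]) :
  (forall i, (m <= i < n)%N -> cbounded_meas (F i)) ->
  cpair g (fun x => \sum_(m <= i < n) F i x) = \sum_(m <= i < n) cpair g (F i).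
Proof.
have z : cpair g (fun=> 0) = 0.
  rewrite -[RHS](mul0r (cpair g (fun=> 0))) -(cpairZ 0 cbounded_meas0).
  by apply: eq_cpair => x _; rewrite mul0r.
elim: n => [|n IH] bF.
  by rewrite big_geq// -[RHS]z; apply: eq_cpair => x _; rewrite big_geq.
have [mn|nm] := leqP m n; last first.
  by rewrite big_geq// -[RHS]z; apply: eq_cpair => x _; rewrite big_geq.
have bF' i : (m <= i < n)%N -> cbounded_meas (F i).
  by move=> /andP[mi ni]; apply: bF; rewrite mi ltnW.
rewrite big_nat_recr//= -IH// -cpairD.
- by apply: eq_cpair => x _; rewrite big_nat_recr.
- exact: cbounded_meas_sum.
- by apply: bF; rewrite mn /=.
Qed.

(* Rotate the integral onto the positive real axis. *)
Lemma norm_cpair w M : cbounded_meas w ->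
  {in I01, forall x, `|w x| <= M%:C%C} ->
  `|cpair g w| <= (M * Rintegral mu I01 (fun x => `|g x|))%:C%C.
Proof.
move=> bw wM.
have ign : mu.-integrable I01 (EFin \o (fun x =>
  `|g x|)) by exact: integrable_norm ig.
have M0 : 0 <= M.
  have := wM 0; rewrite inE /= in_itv/= lexx ler01 => /(_ isT) h.
  by rewrite -(ler0c M); exact: le_trans h.
set z := cpair g w; have [->|z0] := eqVneq z 0.
  by rewrite normr0 ler0c mulr_ge0// Rintegral_ge0.
pose c := `|z| / z.
have c1 : `|c| = 1 by rewrite normrM normr_id normfV divff// normr_eq0.
have cz : cpair g (fun x => c * w x) = `|z|.
  by rewrite cpairZ// -/z divfK.
have zR : `|z| = (Re `|z|)%:C%C by rewrite normc_def.
rewrite zR lecR -cz cpairE /=.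
apply: (le_trans (ler_norm _));
  apply: (le_trans (le_normr_Rintegral _ _)) => //.
  by apply: bounded_meas_integrable => //; have [] := cbounded_measZ c bw.
rewrite -RintegralZl//; apply: le_Rintegral => //.
- apply: integrable_norm; apply: bounded_meas_integrable => //.
  by have [] := cbounded_measZ c bw.
- exact: (integrableZl _ _ ign).
- move=> x xI; rewrite normrM mulrC ler_wpM2r// -lecR.
  apply: (le_trans (normc_ge_Re _)); rewrite normrM c1 mul1r; apply: wM.
  by rewrite inE.
Qed.

End pairing.

(** * Integration by parts with an integrable derivative *)

Section fubini_triangle.
Context {R : realType}.
Local Notation mu := lebesgue_measure.
Implicit Types (u h : R -> R).

(** Both sides integrate [u x * h t] over the region [t <= x], and the product of the two L_1 norms
    justifies exchanging the order. *)
Lemma Rintegral_triangle u h : mu.-integrable setT (EFin \o u) ->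
  mu.-integrable setT (EFin \o h) ->
  Rintegral mu setT (fun x => u x * Rintegral mu `]-oo, x] h) =
  Rintegral mu setT (fun t => h t * Rintegral mu `[t, +oo[ u).
Proof.
move=> iu ih.
have mu1 : measurable_fun setT u by move/integrableP : iu =>
  [/measurable_EFinP].
have mh : measurable_fun setT h by move/integrableP : ih => [/measurable_EFinP].
pose f (p : R * R) : \bar R := (u p.1 * (h p.2 * (p.2 <= p.1)%R%:R))%:E.
have mf : measurable_fun setT f.
  apply/measurable_EFinP; apply: measurable_funM; first exact: measurableT_comp.
  apply: measurable_funM; first exact: measurableT_comp.
  have mb : measurable_fun setT (fun p : R * R => p.2 <= p.1).
    by apply: measurable_fun_ler; [exact: measurable_snd|exact: measurable_fst].
  by apply: (measurableT_comp (f := fun c : bool => c%:R : R)).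
have mabs : measurable_fun setT (abse \o f) by exact: measurableT_comp.
have innerE g (D : set R) a : measurable D -> mu.-integrable setT (EFin \o g) ->
    (\int[mu]_x (a * (g x * (x \in D)%:R))%:E = (a * Rintegral mu D g)%:E)%E.
  move=> mD ig; have igD : mu.-integrable D (EFin \o g) by exact: integrableS
    ig.
  rewrite EFinM /Rintegral fineK; last exact: integrable_fin_num.
  rewrite [in RHS]integral_mkcond -integralZl//;
    last exact: ((integrable_mkcond (EFin \o g) mD).1 igD).
  apply: eq_integral => x _; rewrite patchE; case: (x \in D) => /=.
    by rewrite mulr1.
  by rewrite !mulr0 mule0.
have inner1 x : (\int[mu]_t f (x, t) = (u x * Rintegral mu `]-oo, x] h)%:E)%E.
  rewrite -innerE//; apply: eq_integral => t _; rewrite /f /=;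
    congr (_ * (_ * _%:R))%:E.
  by rewrite mem_setE in_itv.
have inner2 t : (\int[mu]_x f (x, t) = (h t * Rintegral mu `[t, +oo[ u)%:E)%E.
  rewrite -innerE//; apply: eq_integral => x _; rewrite /f /=; congr EFin.
  by rewrite mem_setE in_itv/= andbT; ring.
have intf : (mu \x mu)%E.-integrable setT f.
  apply/integrable12ltyP => //.
  apply: (@le_lt_trans _ _ (\int[mu]_x (`|u x|%:E * \int[mu]_t `|h t|%:E))%E).
    apply: ge0_le_integral => //.
    - by move=> x _; exact: integral_ge0.
    - exact: (measurable_fun_fubini_tonelli_F (m2 :=
        mu) (abse \o f) mabs (fun p => abse_ge0 (f p))).
    - apply: emeasurable_funM; last exact: measurable_cst.
      by apply/measurable_EFinP; exact: measurableT_comp.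
    - move=> x _; rewrite -ge0_integralZl//.
      + apply: ge0_le_integral => //.
        * by apply: measurableT_comp => //;
            exact: measurableT_comp mf (measurable_pair1 _).
        * by apply/measurable_EFinP; apply: measurable_funM => //;
            exact: measurableT_comp.
        * move=> t _; rewrite /f /= lee_fin !normrM ler_wpM2l// ler_piMr//.
          by case: (t <= x); rewrite ?normr1 ?normr0.
      + by apply/measurable_EFinP; exact: measurableT_comp.
  have hfin : (\int[mu]_t `|h t|%:E < +oo)%E by case/integrableP : ih.
  rewrite -(@fineK _ (\int[mu]_t `|h t|%:E)%E); last first.
    by rewrite ge0_fin_numE// integral_ge0.
  rewrite ge0_integralZr//.
  - rewrite muleC lte_mul_pinfty//; last by case/integrableP : iu.
    by rewrite lee_fin fine_ge0// integral_ge0.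
  - by apply/measurable_EFinP; exact: measurableT_comp.
  - by rewrite lee_fin fine_ge0// integral_ge0.
have /(congr1 fine) := Fubini intf.
under eq_integral do rewrite inner1.
by under [in X in _ = fine X -> _]eq_integral do rewrite inner2.
Qed.

(* As [h] is merely integrable, this rests on Fubini's theorem on a triangle. *)
Lemma Rintegral_by_parts (f h u : R -> R) :
  mu.-integrable `[0, 1] (EFin \o f) ->
  mu.-integrable `[0, 1] (EFin \o h) -> bounded_meas u ->
  (forall x, 0 <= x <= 1 -> f x - f 0 = Rintegral mu `[0, x] h) ->
  Rintegral mu `[0, 1] u = 0 ->
  Rintegral mu `[0, 1] (fun x => f x * u x) =
  Rintegral mu `[0, 1] (fun x => h x * - Rintegral mu `[0, x] u).
Proof.
move=> if_ ih bu fE u0.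
have i1 := @integrable01_cst1 R.
have iu : mu.-integrable `[0, 1] (EFin \o u).
  rewrite (_ : u = fun x => 1 * u x); first exact: bounded_meas_integrable.
  by apply/funext => x; rewrite mul1r.
have ifu := bounded_meas_integrable if_ bu.
pose I01 : set R := `[0, 1]%classic.
have mI : measurable I01 by exact: measurable_itv.
have iu' : mu.-integrable setT (EFin \o (u \_ I01)).
  by have := (@integrable_mkcond _ _ _ mu _ (EFin \o u) mI).1 iu;
    rewrite restrict_EFin.
have ih' : mu.-integrable setT (EFin \o (h \_ I01)).
  by have := (@integrable_mkcond _ _ _ mu _ (EFin \o h) mI).1 ih;
    rewrite restrict_EFin.
have := Rintegral_triangle iu' ih'.
have -> : (fun x => (u \_ I01) x * Rintegral mu `]-oo, x] (h \_ I01)) =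
    (fun x => (f x - f 0) * u x) \_ I01.
  apply/funext => x; rewrite !patchE; case: ifPn => xI; last by rewrite mul0r.
  rewrite mulrC fE; last by move: xI; rewrite inE /I01 /= in_itv.
  congr (_ * _); rewrite -Rintegral_mkcondr; congr (Rintegral _ _ _).
  move: xI; rewrite inE /I01 /= in_itv/= => /andP[x0 x1].
  apply/seteqP; split => y; rewrite /I01 /= !in_itv/=;
    first by case=> yx /andP[-> _].
  by move=> /andP[y0 yx]; rewrite y0 yx (le_trans yx x1).
have -> : (fun t => (h \_ I01) t * Rintegral mu `[t, +oo[ (u \_ I01)) =
    (fun t => h t * - Rintegral mu `[0, t] u) \_ I01.
  apply/funext => t; rewrite !patchE; case: ifPn => tI; last by rewrite mul0r.
  congr (_ * _); rewrite -Rintegral_mkcondr.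
  move: tI; rewrite inE /I01 /= in_itv/= => /andP[t0 t1].
  have -> : `[t, +oo[ `&` I01 = `[t, 1]%classic.
    apply/seteqP; split => y; rewrite /I01 /= !in_itv/= andbT;
      first by case=> -> /andP[_ ->].
    by move=> /andP[ty y1]; rewrite ty y1 (le_trans t0 ty).
  rewrite -Rintegral_itv_obnd_cbnd; last first.
    by apply: integrableS iu => //; apply: subset_itvr; rewrite bnd_simp.
  (* As [u] has mean zero, its integral over [[t, 1]] is minus that over [[0, t]]. *)
  have := Rintegral_itvB (f := u) (a := BLeft 0) (b := BRight 1) (x := t) iu.
  rewrite u0 sub0r => <- //; rewrite bnd_simp//.
rewrite -!Rintegral_mkcond => <-;
  have -> : Rintegral mu I01 (fun x => (f x - f 0) * u x) =
    Rintegral mu I01 (fun x => f x * u x) - f 0 * Rintegral mu I01 u.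
  rewrite -RintegralZl// -RintegralB//; last exact: (integrableZl _ _ iu).
  by apply: eq_Rintegral => x _; rewrite mulrBl.
by rewrite u0 mulr0 subr0.
Qed.

End fubini_triangle.

(** * One step of the recursion for Walsh coefficients *)

Section walsh_recursion.
Context {R : realType}.
Variable b : nat.
Hypothesis hb : (2 <= b)%N.
Local Notation mu := lebesgue_measure.
Local Notation zeta := (@zeta R b).
Local Notation B := (b%:R : R).
Local Notation walc := (@walc R b).
Local Notation I01 := `[0%R, 1%R]%classic.
Local Notation chord := (@chord R b).

Let B0 : 0 < B. Proof. by rewrite ltr0n; lia. Qed.

Let trunc_b_lt0 n (x : R) : x < 0 -> Num.truncn (x * B ^+ n) = 0%N.
Proof.
move=> x0; apply/eqP; rewrite -leqn0 truncn_le_nat (lt_le_trans _ ler01)//.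
by rewrite pmulr_llt0// exprn_gt0.
Qed.

(** At negative points truncations and digits take the default value 0, so [walc k] is a step
    function, hence measurable, on the whole line. *)
Lemma walc_stepE_real k n (x : R) : (k < b ^ n)%N ->
  walc k x = walc_step b k n (Num.truncn (x * B ^+ n)).
Proof.
have [x0|x0] := leP 0 x; first exact: walc_stepE.
move=> kn; rewrite walcE /walc_step trunc_b_lt0//; congr (_ ^+ _).
by apply: eq_bigr => a _; rewrite /real_digit trunc_b_lt0// div0n.
Qed.

Lemma norm_walc k x : `|walc k x| = 1.
Proof. by rewrite walcE norm_zetaX. Qed.

Lemma norm_walc_step k n j : `|walc_step b k n j| = 1 :> R[i].
Proof. exact: norm_zetaX. Qed.

Let Re_le1 (z : R[i]) : `|z| = 1 -> `|complex.Re z| <= 1.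
Proof. by move=> z1; rewrite -lecR; have := normc_ge_Re z; rewrite z1. Qed.

Lemma normc_ge_Im (z : R[i]) : `|complex.Im z|%:C%C <= `|z|.
Proof.
have := normc_ge_Re (z * 'i%C).
by rewrite ReiNIm normrN normrM [`|'i%C|]normc_def /= expr0n expr1n add0r
  sqrtr1 mulr1.
Qed.

Let Im_le1 (z : R[i]) : `|z| = 1 -> `|complex.Im z| <= 1.
Proof. by move=> z1; rewrite -lecR; have := normc_ge_Im z; rewrite z1. Qed.

Lemma cbounded_meas_walc k : cbounded_meas (walc k).
Proof.
split; split.
- rewrite (_ : _ \o _ = fun x : R =>
    complex.Re (walc_step b k k (Num.truncn (x * B ^+ k)))).
    by apply: (measurable_step (fun j => complex.Re (walc_step b k k j)));
      rewrite exprn_gt0.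
  by apply/funext => x /=; rewrite -walc_stepE_real// ltn_expl.
- by exists 1 => x _ /=; exact/Re_le1/norm_walc.
- rewrite (_ : _ \o _ = fun x : R =>
    complex.Im (walc_step b k k (Num.truncn (x * B ^+ k)))).
    by apply: (measurable_step (fun j => complex.Im (walc_step b k k j)));
      rewrite exprn_gt0.
  by apply/funext => x /=; rewrite -walc_stepE_real// ltn_expl.
- by exists 1 => x _ /=; exact/Im_le1/norm_walc.
Qed.

Lemma Rintegral_walc k n (x : R) : (k < b ^ n)%N -> 0 <= x ->
  Rintegral mu `[0, x] (fun y => complex.Re (walc k y)) =
    complex.Re (walc_prim b k n x) / B ^+ n /\
  Rintegral mu `[0, x] (fun y => complex.Im (walc k y)) =
    complex.Im (walc_prim b k n x) / B ^+ n.
Proof.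
move=> kn x0; have Bn : 0 < B ^+ n by rewrite exprn_gt0.
pose GR j := complex.Re (walc_step b k n j : R[i]).
pose GI j := complex.Im (walc_step b k n j : R[i]).
have sumE (s : seq nat) : complex.Re (\sum_(j <- s) walc_step b k n j : R[i]) =
  \sum_(j <- s) GR j /\
    complex.Im (\sum_(j <- s) walc_step b k n j : R[i]) = \sum_(j <- s) GI j.
  elim: s => [|j s [IHr IHi]]; first by rewrite !big_nil.
  by rewrite !big_cons -IHr -IHi /GR /GI; split; case: (walc_step _ _ _ _);
    case: (\sum_(_ <- s) _).
have [sr si] := sumE (index_iota 0 (trunc_b b n x)).
split.
  rewrite (_ : (fun y => _) = fun y => GR (Num.truncn (y * B ^+ n)));
    last first.
    by apply/funext => y; rewrite /GR (walc_stepE_real _ kn).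
  rewrite (@Rintegral_step _ _ _ _ 1)//; last by move=> j;
    exact/Re_le1/norm_walc_step.
  congr (_ / _); rewrite /walc_prim -/(trunc_b b n x) -sr /GR.
  by case: (\sum_(_ <- _) _) => p q; case: (walc_step _ _ _ _) => p' q' /=;
    rewrite mulr0 subr0.
rewrite (_ : (fun y => _) = fun y => GI (Num.truncn (y * B ^+ n))); last first.
  by apply/funext => y; rewrite /GI (walc_stepE_real _ kn).
rewrite (@Rintegral_step _ _ _ _ 1)//; last by move=> j;
  exact/Im_le1/norm_walc_step.
congr (_ / _); rewrite /walc_prim -/(trunc_b b n x) -si /GI.
by case: (\sum_(_ <- _) _) => p q; case: (walc_step _ _ _ _) => p' q' /=;
  rewrite mulr0 add0r.
Qed.

Section one_step.
Variables (n m k' : nat).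
Hypotheses (n0 : (0 < n)%N) (mb : (0 < m < b)%N) (kn : (k' < b ^ n.-1)%N).
Let K := (m * b ^ n.-1 + k')%N.

Let Kn : (K < b ^ n)%N.
Proof.
rewrite /K -[in X in (_ < X)%N](prednK n0) expnS.
apply: (@leq_trans (m.+1 * b ^ n.-1)); first by rewrite mulSn; lia.
by rewrite leq_mul2r; case/andP: mb => _ ->; rewrite orbT.
Qed.

(** At 1 the fractional part and the digit at position [n] are 0, so the two terms of [walc_primE]
    cancel. Hence [walc K] has mean zero and integration by parts leaves no boundary term. *)
Lemma walc_prim1 : walc_prim b K n (1 : R) = 0.
Proof.
have bn0 : (0 < b ^ n)%N by rewrite expn_gt0; lia.
have T1 : trunc_b b n (1 : R) = (b ^ n)%N.
  by rewrite /trunc_b mul1r -natrX natrK.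
have d1 : real_digit b (1 : R) n = 0%N.
  rewrite /real_digit -/(trunc_b b n 1) T1 -(prednK n0) expnSr.
  by rewrite modnMl.
rewrite walc_primE// T1 mul1r -natrX subrr add0r walc_cons// d1 muln0 expr0
  mul1r.
by rewrite mulNr subrr.
Qed.

(** The absolute value changes nothing on [[0, 1]] and makes [walc_primE] applicable on the whole
    line, where measurability is asked. *)
Lemma cbounded_meas_walc_prim : cbounded_meas (fun x : R =>
  walc_prim b K n `|x|).
Proof.
have mN : measurable_fun setT (fun x : R => `|x|) by exact: normr_measurable.
pose y (x : R) := `|x| * B ^+ n - (Num.truncn (`|x| * B ^+ n))%:R.
have my : bounded_meas y.
  split.
    apply: measurable_funB.
      by apply: measurable_funM; [exact: mN|exact: measurable_cst].
    have mstep : measurable_fun setT (fun x : R =>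
      (Num.truncn (x * B ^+ n))%:R : R).
      by apply: (measurable_step (fun j => j%:R)); rewrite exprn_gt0.
    exact: (measurableT_comp mstep mN).
  exists 1 => x _; rewrite /y.
  have /andP[l1 l2] : (Num.truncn (`|x| * B ^+ n))%:R <= `|x| * B ^+ n <
      (Num.truncn (`|x| * B ^+ n)).+1%:R.
    by apply: truncn_itv; rewrite mulr_ge0// exprn_ge0// ltW.
  by rewrite ger0_norm ?subr_ge0// lerBlDr addrC natr1 ltW.
have bw j : cbounded_meas (fun x : R => walc j `|x|).
  have [[mr [M rM]] [mi [M' iM]]] := cbounded_meas_walc j.
  split; split; first exact: (measurableT_comp mr mN).
  - by exists 1 => x _ /=; exact/Re_le1/norm_walc.
  - exact: (measurableT_comp mi mN).
  - by exists 1 => x _ /=; exact/Im_le1/norm_walc.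
apply: (cbounded_meas_ext (w := fun x => (1 - zeta ^+ m)^-1 * walc k' `|x| +
  ((y x)%:C%C * walc K `|x| + - (1 - zeta ^+ m)^-1 * walc K `|x|))).
  by move=> x; rewrite walc_primE// -mulrDl.
apply: cbounded_measD; first exact: cbounded_measZ.
by apply: cbounded_measD; [exact: cbounded_measM|exact: cbounded_measZ].
Qed.

Variables (f h : R -> R).
Hypotheses (if_ : mu.-integrable I01 (EFin \o f)) (ih : mu.-integrable I01
  (EFin \o h)).
Hypothesis fE : forall x, 0 <= x <= 1 -> f x - f 0 = Rintegral mu `[0, x] h.

Lemma cpair_walc_by_parts :
  cpair f (walc K) = - (B ^- n)%:C%C * cpair h (fun x => walc_prim b K n `|x|).
Proof.
have [br bi] := cbounded_meas_walc K.
have [r1 i1] := Rintegral_walc Kn ler01; rewrite walc_prim1 /= !mul0r in r1 i1.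
have primZ (x : R) : 0 <= x -> (- (B ^- n)%:C * walc_prim b K n `|x|)%C =
   (- Rintegral mu `[0, x] (fun y => complex.Re (walc K y)) +i*
    - Rintegral mu `[0, x] (fun y => complex.Im (walc K y)))%C.
  move=> x0; have [-> ->] := Rintegral_walc Kn x0; rewrite ger0_norm//.
  case: (walc_prim b K n x) => p q; apply/eqP; rewrite eq_complex /=.
  by apply/andP; split; apply/eqP; ring.
rewrite -cpairZ//; last exact: cbounded_meas_walc_prim.
rewrite !cpairE; congr (_ +i* _)%C.
  rewrite (Rintegral_by_parts if_ ih br)//.
  apply: eq_Rintegral => x; rewrite inE /= in_itv/= => /andP[x0 _].
  by rewrite primZ.
rewrite (Rintegral_by_parts if_ ih bi)//.
apply: eq_Rintegral => x; rewrite inE /= in_itv/= => /andP[x0 _].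
by rewrite primZ.
Qed.

Lemma norm_cpair_walc_le N :
  `|cpair f (walc K)| <= (B ^- n)%:C%C *
    ((chord^-1)%:C%C * `|cpair h (walc k')| + (chord^-1)%:C%C * `|cpair h (walc
      K)| +
     \sum_(1 <= c < N.+1) \sum_(1 <= i < b) (B ^- c)%:C%C * (chord^-1)%:C%C *
        `|cpair h (walc (i * b ^ (n + c).-1 + K))| +
     (B ^- N * Rintegral mu I01 (fun x => `|h x|))%:C%C).
Proof.
have bw := cbounded_meas_walc.
have Bn : 0 <= B ^- n by rewrite invr_ge0 exprn_ge0// ltW.
rewrite cpair_walc_by_parts normrM normrN [`|_%:C%C|]ger0_norm ?ler0c//
  ler_wpM2l ?ler0c//.
pose S c (x : R) := \sum_(1 <= i < b) ((B ^- c)%:C%C * digit_coef b i) *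
     walc (i * b ^ (n + c).-1 + K) x.
pose A (x : R) := (1 - zeta ^+ m)^-1 * walc k' x +
  (1 / 2 - (1 - zeta ^+ m)^-1) * walc K x + \sum_(1 <= c < N.+1) S c x.
have bS c : cbounded_meas (S c).
  by apply: cbounded_meas_sum => i _; exact: cbounded_measZ.
have b1 : cbounded_meas (fun x => (1 - zeta ^+ m)^-1 * walc k' x +
    (1 / 2 - (1 - zeta ^+ m)^-1) * walc K x).
  by apply: cbounded_measD; exact: cbounded_measZ.
have bSS : cbounded_meas (fun x => \sum_(1 <= c < N.+1) S c x).
  by apply: cbounded_meas_sum => c _; exact: bS.
have bA : cbounded_meas A by exact: cbounded_measD b1 bSS.
have bP := cbounded_meas_walc_prim.
have bNA := cbounded_measZ (-1) bA.
have bD := cbounded_measD bP bNA.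
(* Split off the finite expansion [A], paired term by term; on [[0, 1]] the rest is [rho] times a
   Walsh function, of modulus at most [B ^- N]. *)
rewrite (_ : (fun x => walc_prim b K n `|x|) =
  (fun x => A x + (walc_prim b K n `|x| + -1 * A x))); last first.
  by apply/funext => x; rewrite mulN1r addrCA subrr addr0.
rewrite cpairD// (le_trans (ler_normD _ _))// lerD//; last first.
  apply: norm_cpair => // x; rewrite inE /= in_itv/= => /andP[x0 x1].
  rewrite [`|x|]ger0_norm//.
  have [rho rhoN primE] := walc_prim_expansion hb N n0 kn mb x0.
  rewrite [walc_prim _ _ _ _]primE mulN1r -/K [X in `|X|](_ : _ =
    rho%:C%C * walc K x).
    rewrite normrM norm_walc mulr1 normc_def /= expr0n addr0 sqrtr_sqr lecR.
    exact: rhoN.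
  by rewrite /A /S addrAC subrr add0r.
have -> : cpair h A = (1 - zeta ^+ m)^-1 * cpair h (walc k') +
    (1 / 2 - (1 - zeta ^+ m)^-1) * cpair h (walc K) +
    \sum_(1 <= c < N.+1) \sum_(1 <= i < b) ((B ^- c)%:C%C * digit_coef b i) *
      cpair h (walc (i * b ^ (n + c).-1 + K)).
  rewrite cpairD// cpairD; [|by []|exact: cbounded_measZ|exact: cbounded_measZ].
  rewrite !cpairZ// cpair_sum//; congr (_ + _); apply: eq_bigr => c _.
  rewrite cpair_sum//; last by move=> i _; exact: cbounded_measZ.
  by apply: eq_bigr => i _; rewrite cpairZ.
rewrite (le_trans (ler_normD _ _))// lerD//.
  rewrite (le_trans (ler_normD _ _))// lerD// normrM ler_wpM2r//.
    exact: norm_inv_chord.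
  exact: norm_half_chord.
rewrite (le_trans (ler_norm_sum _ _ _))//; apply: ler_sum => c _.
rewrite (le_trans (ler_norm_sum _ _ _))// big_nat [leRHS]big_nat.
apply: ler_sum => i ib.
rewrite normrM ler_wpM2r// normrM ger0_norm; last first.
  by rewrite ler0c invr_ge0 exprn_ge0// ltW.
rewrite ler_wpM2l ?norm_digit_coef//.
by rewrite ler0c invr_ge0 exprn_ge0// ltW.
Qed.

End one_step.

End walsh_recursion.

(** * The bound *)

Section walsh_bound.
Context {R : realType}.
Variable b : nat.
Hypothesis hb : (2 <= b)%N.
Local Notation mu := lebesgue_measure.
Local Notation B := (b%:R : R).
Local Notation walc := (@walc R b).
Local Notation I01 := `[0%R, 1%R]%classic.
Local Notation chord := (@chord R b).

Let B0 : 0 < B. Proof. by rewrite ltr0n; lia. Qed.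
Let S0 : 0 < chord. Proof. exact: chord_gt0. Qed.

Definition walsh_norm (g : R -> R) (k : nat) : R :=
  complex.Re `|cpair g (walc k)|.

Lemma walsh_normE g k : `|cpair g (walc k)| = (walsh_norm g k)%:C%C.
Proof. by rewrite /walsh_norm normc_def. Qed.

Lemma walsh_norm0 g : walsh_norm g 0 = `|Rintegral mu I01 g|.
Proof.
have w0 x : walc 0 x = 1 by rewrite walcE /digit_pos big_nil expr0.
apply: complexI; rewrite -walsh_normE cpairE.
have -> : Rintegral mu I01 (fun x => g x * complex.Re (walc 0 x)) =
  Rintegral mu I01 g.
  by apply: eq_Rintegral => x _; rewrite w0 /= mulr1.
have -> : Rintegral mu I01 (fun x => g x * complex.Im (walc 0 x)) =
    Rintegral mu I01 (fun=> 0).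
  by apply: eq_Rintegral => x _; rewrite w0 /= mulr0.
by rewrite Rintegral_cst// mul0r normc_def /= expr0n addr0 sqrtr_sqr.
Qed.

Lemma walsh_norm_le g k : mu.-integrable I01 (EFin \o g) ->
  walsh_norm g k <= Rintegral mu I01 (fun x => `|g x|).
Proof.
move=> ig; rewrite -lecR -walsh_normE -[X in X%:C%C]mul1r.
apply: norm_cpair => //; first exact: cbounded_meas_walc.
by move=> x _; rewrite norm_walc.
Qed.

Lemma walsh_norm_step n m k f h N : (0 < n)%N -> (0 < m < b)%N ->
  (k < b ^ n.-1)%N ->
  mu.-integrable I01 (EFin \o f) -> mu.-integrable I01 (EFin \o h) ->
  (forall x, 0 <= x <= 1 -> f x - f 0 = Rintegral mu `[0, x] h) ->
  walsh_norm f (m * b ^ n.-1 + k) <= B ^- n / chord *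
    (walsh_norm h k + walsh_norm h (m * b ^ n.-1 + k) +
     \sum_(1 <= c < N.+1) \sum_(1 <= i < b) B ^- c *
        walsh_norm h (i * b ^ (n + c).-1 + (m * b ^ n.-1 + k))) +
  B ^- n * (B ^- N * Rintegral mu I01 (fun x => `|h x|)).
Proof.
move=> n0 mb kn if_ ih fE.
have := norm_cpair_walc_le hb n0 mb kn if_ ih fE N.
rewrite !walsh_normE.
under [X in _ <= _ * (_ + X + _)]eq_bigr => c _.
  under eq_bigr => i _ do rewrite walsh_normE -!rmorphM.
  rewrite -rmorph_sum.
  over.
rewrite -rmorph_sum -!rmorphM -!rmorphD -rmorphM lecR => /le_trans; apply.
rewrite mulrDr lerD2r -mulrA ler_wpM2l ?invr_ge0 ?exprn_ge0 ?(ltW B0)//.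
rewrite !mulrDr !lerD// mulr_sumr; apply: ler_sum => c _.
by rewrite mulr_sumr; apply: ler_sum => i _; rewrite mulrCA mulrA.
Qed.

Lemma expVn_small (C e : R) : 0 <= C -> 0 < e -> exists N, B ^- N * C <= e.
Proof.
move=> C0 e0; exists (Num.truncn (C / e)).+1; set N := _.+1.
have BN : 0 < B ^+ N by rewrite exprn_gt0.
rewrite mulrC ler_pdivrMr// -ler_pdivrMl// mulrC;
  apply: (le_trans (ltW (truncnS_gt _))).
by rewrite -/N -natrX ler_nat ltnW// ltn_expl.
Qed.

(** Induction on [r], with the hypothesis applied to the shifted family starting at [g 1]. Index 0
    is direct, the coefficient being the mean; any other index takes one step of the recursion. *)
Lemma walsh_norm_bound r (g : nat -> R -> R) :
  (forall s, (s <= r)%N -> mu.-integrable I01 (EFin \o g s)) ->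
  (forall s, (s < r)%N -> forall x, 0 <= x <= 1 ->
    g s x - g s 0 = Rintegral mu `[0, x] (g s.+1)) ->
  forall k, walsh_norm (g 0%N) k <=
    \sum_(0 <= s < r.+1) `|Rintegral mu I01 (g s)| * mean_bound b chord s
      (digit_pos b k)
    + Rintegral mu I01 (fun x =>
        `|g r x|) * rem_bound b chord r (digit_pos b k).
Proof.
have int0 (h : R -> R) : 0 <= Rintegral mu I01 (fun x => `|h x|).
  by apply: Rintegral_ge0 => x _.
have mb0 := mean_bound_ge0 hb S0; have rb0 := rem_bound_ge0 hb S0.
elim: r g => [|r IH] g ig gE k.
  have [->|k0] := posnP k.
    by rewrite walsh_norm0 big_nat1 /mean_bound /= !mulr1 mulr0 addr0.
  rewrite (le_trans (walsh_norm_le k (ig 0%N _)))// -[leLHS]add0r lerD//.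
    by rewrite big_nat1 mulr_ge0.
  rewrite /rem_bound (_ : digit_pos b k != [::]) ?mulr1//.
  have [a [m [k' [a0 mb kb ->]]]] := nat_top_digit hb k0.
  by rewrite digit_pos_cons.
have [->|k0] := posnP k.
  rewrite walsh_norm0 big_nat_recl// /mean_bound /= mulr1 -addrA lerDl
    addr_ge0//.
    by apply: sumr_ge0 => s _; rewrite mulr_ge0// mulr0.
  exact: mulr_ge0 (int0 _) (rb0 r.+1 _).
have [n [m [k' [n0 mb kb kE]]]] := nat_top_digit hb k0.
have kn : (k < b ^ n)%N.
  rewrite kE -[in X in (_ < X)%N](prednK n0) expnS.
  apply: (@leq_trans (m.+1 * b ^ n.-1)); first by rewrite mulSn; lia.
  by rewrite leq_mul2r; case/andP: mb => _ ->; rewrite orbT.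
pose l := digit_pos b k'.
have kl : digit_pos b k = n :: l by rewrite kE digit_pos_cons.
have sl : sorted gtn (n :: l) by rewrite -kl; exact: digit_pos_sorted.
pose T l := \sum_(0 <= s < r.+1) `|Rintegral mu I01 (g s.+1)| * mean_bound b
  chord s l
    + Rintegral mu I01 (fun x => `|g r.+1 x|) * rem_bound b chord r l.
have IH' j : walsh_norm (g 1%N) j <= T (digit_pos b j).
  by apply: (IH (fun s => g s.+1)) => s sr; [exact: ig|exact: gE].
have step N : walsh_norm (g 0%N) k <= walsh_step b chord T N n l +
    B ^- n * (B ^- N * Rintegral mu I01 (fun x => `|g 1%N x|)).
  rewrite kE (le_trans (walsh_norm_step N n0 mb kb (ig 0%N _) (ig 1%N _) (gE
    0%N _)))//.
  rewrite lerD2r /walsh_step ler_wpM2l//.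
    by rewrite divr_ge0 ?invr_ge0 ?exprn_ge0 ?(ltW B0) ?(ltW S0).
  rewrite -kE !lerD//; first by rewrite -kl; exact: IH'.
  rewrite big_nat [leRHS]big_nat; apply: ler_sum => c /andP[c0 _].
  (* The bound sees only positions, so the [b - 1] values of the additional digit share it; this is
     the factor [B - 1] in [walsh_step]. *)
  apply: (@le_trans _ _ (\sum_(1 <= i < b) B ^- c * T ((n + c)%N :: n :: l))).
    rewrite big_nat [leRHS]big_nat; apply: ler_sum => i ib.
    rewrite ler_wpM2l ?invr_ge0 ?exprn_ge0 ?(ltW B0)//.
    apply: (le_trans (IH' _)); rewrite digit_pos_cons ?kl// ?ltn_addr//.
    by apply: (leq_trans kn); apply: leq_pexp2l; lia.
  rewrite sumr_const_nat -[leLHS]mulr_natl natrB ?mulrA//; lia.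
(* [walsh_step] is linear in the bound, so the mean of each derivative and the remainder advance
   separately. *)
have lin N : walsh_step b chord T N n l <=
    \sum_(0 <= s < r.+1) `|Rintegral mu I01 (g s.+1)| * mean_bound b chord s.+1
      (n :: l) +
    Rintegral mu I01 (fun x => `|g r.+1 x|) * rem_bound b chord r.+1 (n :: l).
  have stepD F G : walsh_step b chord (fun l => F l + G l) N n l =
      walsh_step b chord F N n l + walsh_step b chord G N n l.
    rewrite /walsh_step -mulrDr; congr (_ * _).
    under eq_bigr do rewrite mulrDr.
    by rewrite big_split /=; ring.
  have step0 : walsh_step b chord (fun=> 0) N n l = 0.
    by rewrite /walsh_step big1 ?addr0 ?mulr0// => c _; rewrite mulr0.
  rewrite /T stepD walsh_stepZ lerD//; last first.
    by rewrite ler_wpM2l// rem_bound_step.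
  elim: (r.+1) => [|q IHq].
    rewrite [X in X <= _](_ : _ = 0) ?big_geq//.
    by rewrite -[RHS]step0; congr (walsh_step _ _ _ _ _ _);
      apply/funext => l'; rewrite big_geq.
  rewrite big_nat_recr//= [X in X <= _](_ : _ = walsh_step b chord (fun l' =>
     \sum_(0 <= s < q) `|Rintegral mu I01 (g s.+1)| * mean_bound b chord s l')
       N n l +
     walsh_step b chord (fun l' =>
       `|Rintegral mu I01 (g q.+1)| * mean_bound b chord q l') N n l).
    by rewrite lerD// walsh_stepZ ler_wpM2l// mean_bound_step.
  rewrite -stepD; congr (walsh_step _ _ _ _ _ _); apply/funext => l'.
  by rewrite big_nat_recr.
(* The truncation error falls below any [e] for large [N], while the main bound does not depend on
   [N]. *)
rewrite kl big_nat_recl// -addrA; apply/ler_addgt0Pr => e e0.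
have [N Ne] : exists N,
  B ^- N * (B ^- n * Rintegral mu I01 (fun x => `|g 1%N x|)) <= e.
  by apply: expVn_small => //; rewrite mulr_ge0// invr_ge0 exprn_ge0// ltW.
rewrite (le_trans (step N))// lerD//; last by rewrite mulrCA.
by rewrite (le_trans (lin N))// lerDr mulr_ge0.
Qed.

End walsh_bound.

(** * Application to Sobolev functions *)

Section sobolev_integrable.
Context {R : realType}.
Local Notation mu := lebesgue_measure.

Lemma Lfun2_integrable01 (g : R -> R) : g \_ `[0, 1]%classic \in Lfun mu 2%:E ->
  mu.-integrable `[0, 1] (EFin \o g).
Proof.
move=> gL; pose g' := g \_ `[0, 1]%classic.
have mg' : measurable_fun setT g' by have := sub_Lfun_mfun gL; rewrite inE.
have i2 : mu.-integrable `[0, 1] (EFin \o (fun x => g' x ^+ 2)).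
  by apply: integrableS (Lfun2_integrable_sqr gL).
have i1 := @integrable01_cst1 R.
have ig' : mu.-integrable `[0, 1] (EFin \o g').
  (* On the unit interval square integrability suffices, by domination of [|g'|] by
     [1 + g' ^+ 2]. *)
  apply: (le_integrable _ _ _ (integrableD _ i1 i2)) => //.
    by apply/measurable_EFinP; exact: measurable_funTS.
  move=> x _ /=; rewrite lee_fin (ger0_norm (_ : 0 <= 1 + _)); last first.
    by rewrite addr_ge0// sqr_ge0.
  rewrite -real_normK ?num_real//; have := sqr_ge0 (`|g' x| - 1); nra.
apply: eq_integrable ig' => // x xI.
by rewrite /= /g' patchE xI.
Qed.

Lemma sobolev_integrable r (f : R -> R) s : sobolev r f -> (s <= r)%N ->
  mu.-integrable `[0, 1] (EFin \o derive01n s f).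
Proof.
move=> [_ acf fL]; rewrite leq_eqVlt => /predU1P[->|sr].
  exact: Lfun2_integrable01.
apply: continuous_compact_integrable; first exact: segment_compact.
by apply: ac_chain_continuous; exact/abs_continuous_ac_chain/acf.
Qed.

Lemma sobolev_FTC r (f : R -> R) s : sobolev r f -> (s < r)%N ->
  forall x, 0 <= x <= 1 ->
  derive01n s f x - derive01n s f 0 = Rintegral mu `[0, x] (derive01n s.+1 f).
Proof.
move=> sf sr; have [_ acf _] := sf.
apply: (ac_chain_FTC (abs_continuous_ac_chain (acf s sr))).
exact: sobolev_integrable sf sr.
Qed.

End sobolev_integrable.

Theorem theorem3 (R : realType) (b : nat) (hb : (2 <= b)%N)
  (r : nat) (hr : (1 < r)%N) (k : nat) (hk : (0 < k)%N)
  (f : R -> R) (hf : sobolev r f) :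
  `|walsh_coef b f k| <=
  (\sum_(num_digits b k <= s < r.+1)
      `|Rintegral lebesgue_measure `[0, 1] (derive01n s f)|
      * (b%:R ^- mu_per b s k / (2 * sin (pi / b%:R)) ^+ s)
      * (1 + 1 / b%:R + 1 / (b%:R * (b%:R + 1))) ^+ (s - 2)
   + Rintegral lebesgue_measure `[0, 1] (fun x => `|derive01n r f x|)
      * (2 * b%:R ^- mu_per b r k / (2 * sin (pi / b%:R)) ^+ r)
      * (1 + 1 / b%:R + 1 / (b%:R * (b%:R + 1))) ^+ (r - 2)
      * (3 + 2 / b%:R + (2 * b%:R + 1) / (b%:R - 1)))%:C%C.
Proof.
have B2 : 2 <= b%:R :> R by rewrite ler_nat.
have bound := walsh_norm_bound hb (g := fun s => derive01n s f)
  (fun s => sobolev_integrable hf) (fun s => sobolev_FTC hf) k.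
rewrite -[`|_|]/(`|cpair f (walc b k)|) walsh_normE lecR (le_trans bound)//.
have l0 : digit_pos b k != [::].
  have [a [m [k' [a0 mb kb ->]]]] := nat_top_digit hb hk.
  by rewrite digit_pos_cons.
rewrite -/(@chord R b) -/(@growth R b) -/(num_digits b k).
apply: lerD.
  (* Each step removes at most one digit, so means of order below the number of digits do not
     contribute and the sum starts at that number. *)
  have zero s : (s < num_digits b k)%N ->
    mean_bound b (@chord R b) s (digit_pos b k) = 0.
    by move=> sv; rewrite /mean_bound (negbTE l0) sv.
  have eqv s : (num_digits b k <= s)%N ->
      `|Rintegral lebesgue_measure `[0, 1] (derive01n s f)|
        * mean_bound b (@chord R b) s (digit_pos b k) =
      `|Rintegral lebesgue_measure `[0, 1] (derive01n s f)|
      * (b%:R ^- mu_per b s k / (@chord R b) ^+ s) * (@growth R b) ^+ (s - 2).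
    move=> vs; rewrite /mean_bound (negbTE l0) ltnNge vs /= /mu_weight (negbTE
      l0).
    by rewrite mu_perE// mulrA.
  have [vr|rv] := leqP (num_digits b k) r.+1; last first.
    rewrite [leRHS]big_geq ?(ltnW rv)// big_nat big1// => s /andP[_ sr].
    by rewrite zero ?mulr0// (ltn_trans sr).
  rewrite (big_cat_nat (n := num_digits b k))//= big_nat big1 ?add0r;
    last first.
    by move=> s /andP[_ sv]; rewrite zero// mulr0.
  rewrite big_nat [leRHS]big_nat; apply: ler_sum => s /andP[vs _].
  by rewrite eqv.
rewrite -!mulrA ler_wpM2l//; first by apply: Rintegral_ge0 => x _.
case: r hr {bound hf} => [|[|r]]// _.
rewrite /rem_bound /mu_weight (negbTE l0) mu_perE// subSS subSS subn0 [(@growth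
  R b) ^+ r.+1]exprSr.
set M := b%:R ^- _; set S := (@chord R b) ^+ _; set q := (@growth R b).
have M0 : 0 <= M by rewrite invr_ge0 exprn_ge0.
have S0 : 0 < S by rewrite exprn_gt0// chord_gt0.
have q0 : 0 <= q ^+ r by rewrite exprn_ge0// growth_ge0.
(* [rem_bound] carries one more factor [q] than the claim. After the common factor is removed,
   [3 * q <= 6] from [q <= 2] suffices, the other constants on the right being nonnegative. *)
rewrite [leLHS](_ : _ = M / S * q ^+ r * (3 * q)); last by ring.
rewrite [leRHS](_ : _ = M / S * q ^+ r * (2 * (3 + 2 / b%:R + (2 * b%:R + 1) /
  (b%:R - 1)))); last by ring.
rewrite ler_wpM2l//; first by rewrite mulr_ge0// divr_ge0// ltW.
have b0 : 0 < b%:R :> R by lra.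
have i0 : 0 <= 2 / b%:R :> R by rewrite divr_ge0// ltW.
have j0 : 0 <= (2 * b%:R + 1) / (b%:R - 1) :> R by rewrite divr_ge0//; lra.
have q2 : q <= 2.
  rewrite /q /growth (_ : 1 + _ + _ = 1 + (b%:R + 2) / (b%:R * (b%:R + 1))).
    rewrite -[X in _ <= X]/(1 + 1) lerD2l ler_pdivrMr ?mulr_gt0//; nra.
  by field; rewrite !gt_eqF//; lra.
lra.
Qed.
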